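(* Adopt the setting, the scheme, the jump chain and the inward feedback $\bar\pi$ described in the context. There exist constants $C_*\ge 1$ and $h_0\in(0,1]$, with $C_*$ depending only on $(\lambda,\nu_0,d,N,M_b,C_\Omega)$ and $h_0$ depending additionally on $(M_p,r_1)$, such that for every $h\in(0,h_0]$: $$w_{\bar\pi}(x):=\frac1\mu\,\mathbb E_x^{\bar\pi}\Bigl[\sum_{m=0}^\infty\gamma_h^m\,p_\Omega(Y_m)\Bigr]\le C_*h\qquad\text{for all }x\in\overline\Omega .$$ Consequently, for every $\varepsilon>0$ and $h\in(0,h_0]$, $$S_{\varepsilon,h}(\bar\pi)(x)\le\frac{\|f\|_\infty}{\lambda}+\frac{C_*h}{\varepsilon}\qquad\text{for all }x\in\overline\Omega .$$
   Context: Setting. $|\cdot|$ is the Euclidean norm and $\|\cdot\|_\infty$ the pointwise supremum norm. $\Omega\subset\mathbb R^d$ is a bounded domain with $C^2$ boundary and outward unit normal $n$; $A\subset\mathbb R^m$ is compact; $\lambda>0$; $b:\mathbb R^d\times A\to\mathbb R^d$ and $f:\mathbb R^d\times A\to[0,\infty)$ are continuous, bounded, and Lipschitz in $x$ uniformly in $a$, with $\mathrm{Lip}_x(b)<\lambda$; $M_b:=\sup|b|$. There is $\nu>0$ such that for each $x\in\partial\Omega$ some $a\in A$ satisfies $b(x,a)\cdot n(x)\le-\nu$. The Hamiltonian $H(x,p)=\sup_{a\in A}\{-b(x,a)\cdot p-f(x,a)\}$ tends to $\infty$ as $|p|\to\infty$ uniformly in $x\in\overline\Omega$. For a fixed $M_p>0$,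 $p_\Omega(x)=\min\{\mathrm{dist}(x,\overline\Omega),M_p\}$. $N>0$ is fixed with $N\ge\frac12\sup_{x,a}\max_i|b_i(x,a)|$; $h,\varepsilon>0$. Scheme. $(\nabla_hv)_i(x)=\frac{v(x+he_i)-v(x-he_i)}{2h}$, $\Delta_hv(x)=\sum_{i=1}^d\frac{v(x+he_i)-2v(x)+v(x-he_i)}{h^2}$, $\nu_h=Nh$. A policy is a Borel map $\pi:\mathbb R^d\to A$. Set $c_\pi(x)=f(x,\pi(x))+p_\Omega(x)/\varepsilon$, $\mathcal A^\pi v=\lambda v-b(\cdot,\pi)\cdot\nabla_hv-\nu_h\Delta_hv$. $S_{\varepsilon,h}(\pi)$ is the unique bounded Borel function $v$ on $\mathbb R^d$ with $\mathcal A^\pi v=c_\pi$ pointwise. Jump chain. $\Lambda_h=2dN/h$, $\mu=\lambda+\Lambda_h$, $\gamma_h=\Lambda_h/\mu$. Given $\pi$ and $x$, $(Y_m)_{m\ge0}$ is the Markov chain on $x+h\mathbb Z^d$ with $Y_0=x$ which jumps from $y$ to $y\pm he_i$ with probability $q_i^\pm(y)=\frac{N\pm b_i(y,\pi(y))/2}{2dN}$; $\mathbb E_x^\pi$ is its expectation. One has $S_{\varepsilon,h}(\pi)(x)=\mu^{-1}\mathbb E_x^\pi\sum_{m\ge0}\gamma_h^mc_\pi(Y_m)$. Inward feedback. Constants $r_1\in(0,1]$, $\nu_0\in(0,1]$, $C_\Omega\ge1$, a function $\tilde d\in C^{1,1}(\mathbb R^d)$ and a Borel feedback $\bar\pi:\mathbb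 R^d\to A$ are fixed (such objects exist because $\Omega$ is bounded with $C^2$ boundary, $b$ is continuous, and for each $x\in\partial\Omega$ some $a\in A$ satisfies $b(x,a)\cdot n(x)\le-\nu$ with $\nu>0$ independent of $x$) such that: (V1) $|\nabla\tilde d|\le1$ on $\mathbb R^d$ and $\|D^2\tilde d\|_{L^\infty}\le C_\Omega$; (V2) $\tilde d\le0$ on $\overline\Omega$ and $\tilde d(x)\ge\frac12\min\{\mathrm{dist}(x,\overline\Omega),r_1\}$ for $x\notin\overline\Omega$; (V3) $b(x,\bar\pi(x))\cdot\nabla\tilde d(x)\le-\nu_0$ whenever $|\tilde d(x)|\le r_1$. *)

(* Defs.v *)
(* MathComp-Analysis, over an arbitrary [R : realType]. *)
From mathcomp Require Export all_boot all_order all_algebra.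
From mathcomp Require Export all_classical all_reals all_analysis.
Export Order.TTheory GRing.Theory Num.Theory.
Export numFieldNormedType.Exports.
Set Implicit Arguments.
Unset Strict Implicit.
Unset Printing Implicit Defensive.
Local Open Scope classical_set_scope.
Local Open Scope ring_scope.

(* Points of R^d are row vectors.  The library topology and the library notion
   of differentiability on ['rV[R]_d] come from the max norm, hence agree with
   the Euclidean ones; metric quantities use [enorm]. *)
Section Euclidean.
Context {R : realType} {d : nat}.
Implicit Types (u v x y : 'rV[R]_d) (D : set 'rV[R]_d).

Definition dotp u v : R := \sum_(i < d) u 0 i * v 0 i.
Definition enorm u : R := Num.sqrt (\sum_(i < d) u 0 i ^+ 2).
Definition edistance x D : R := inf [set enorm (x - y) | y in D].
Definition unitv (i : 'I_d) : 'rV[R]_d := delta_mx 0 i.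
Definition frontier D : set 'rV[R]_d := closure D `\` interior D.

Definition grad (g : 'rV[R]_d -> R) x : 'rV[R]_d :=
  \row_(i < d) 'D_(unitv i) g x.

(* The Hessian is ['J (grad g) x]. *)
Definition C2_on (U : set 'rV[R]_d) (g : 'rV[R]_d -> R) : Prop :=
  (forall x, U x -> differentiable g x) /\
  (forall x, U x -> differentiable (grad g) x) /\
  (forall x, U x -> {for x, continuous (fun y => 'J (grad g) y)}).

Definition C11 (g : 'rV[R]_d -> R) : Prop :=
  (forall x, differentiable g x) /\
  exists L : R, forall x y, enorm (grad g x - grad g y) <= L * enorm (x - y).

(* Sets of Lebesgue measure zero: countable covers by boxes of arbitrarily
   small total volume. *)
Definition lebesgue_null (Z : set 'rV[R]_d) : Prop :=
  forall e : R, 0 < e -> exists lo hi : nat -> 'rV[R]_d,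
    (forall k i, lo k 0 i <= hi k 0 i) /\
    Z `<=` \bigcup_k [set x | forall i, lo k 0 i <= x 0 i <= hi k 0 i] /\
    (\sum_(0 <= k <oo) (\prod_(i < d) (hi k 0 i - lo k 0 i))%:E <= e%:E)%E.

(* ||D^2 g||_{L^oo} <= C, for the Euclidean operator norm of the Hessian,
   which for a C^{1,1} function exists almost everywhere. *)
Definition hessian_Linfty_le (g : 'rV[R]_d -> R) (C : R) : Prop :=
  exists2 Z : set 'rV[R]_d, lebesgue_null Z &
    forall x, ~ Z x -> differentiable (grad g) x /\
      forall v, enorm (v *m 'J (grad g) x) <= C * enorm v.

(* [Om] has C^2 boundary and [n] is its outward unit normal: near each boundary
   point, [Om] is a sublevel set of a C^2 function with nonzero gradient on the
   boundary. *)
Definition C2_boundary_normal (Om : set 'rV[R]_d) (n : 'rV[R]_d -> 'rV[R]_d) :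
    Prop :=
  forall x0, frontier Om x0 ->
  exists (U : set 'rV[R]_d) (phi : 'rV[R]_d -> R),
    [/\ open U, U x0, C2_on U phi,
        Om `&` U = [set x | U x /\ phi x < 0] &
        forall x, U x -> frontier Om x ->
          grad phi x != 0 /\ n x = (enorm (grad phi x))^-1 *: grad phi x].

End Euclidean.

Definition borel_map {T U : topologicalType} (g : T -> U) : Prop :=
  forall B : set U, <<s @open U >> B -> <<s @open T >> (g @^-1` B).

Section Setting.
Context {R : realType} {d m : nat}.
Variables (A : set 'rV[R]_m) (Om : set 'rV[R]_d).

(* Data on R^d x A are total functions on R^d x R^m constrained only on A. *)

Definition bounded_on_A {k} (g : 'rV[R]_d -> 'rV[R]_m -> 'rV[R]_k) : Prop :=
  exists K : R, forall x a, A a -> enorm (g x a) <= K.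

Definition lipschitz_in_x {k} (g : 'rV[R]_d -> 'rV[R]_m -> 'rV[R]_k) : Prop :=
  exists L : R, forall x y a, A a ->
    enorm (g x a - g y a) <= L * enorm (x - y).

Definition lip_x {k} (g : 'rV[R]_d -> 'rV[R]_m -> 'rV[R]_k) : R :=
  sup [set r | exists x y a, [/\ A a, x != y &
                 r = enorm (g x a - g y a) / enorm (x - y)]].

Definition continuous_on_A {V : topologicalType}
    (g : 'rV[R]_d -> 'rV[R]_m -> V) : Prop :=
  {within [set: 'rV[R]_d] `*` A, continuous (fun z => g z.1 z.2)}.

Definition sup_enorm {k} (g : 'rV[R]_d -> 'rV[R]_m -> 'rV[R]_k) : R :=
  sup [set enorm (g z.1 z.2) | z in [set: 'rV[R]_d] `*` A].

Definition sup_max_entry {k} (g : 'rV[R]_d -> 'rV[R]_m -> 'rV[R]_k) : R :=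
  sup [set \big[Num.max/0]_(i < k) `|g z.1 z.2 0 i|
      | z in [set: 'rV[R]_d] `*` A].

Definition sup_abs (g : 'rV[R]_d -> 'rV[R]_m -> R) : R :=
  sup [set `|g z.1 z.2| | z in [set: 'rV[R]_d] `*` A].

Definition hamiltonian (b : 'rV[R]_d -> 'rV[R]_m -> 'rV[R]_d)
    (f : 'rV[R]_d -> 'rV[R]_m -> R) (x p : 'rV[R]_d) : R :=
  sup [set - dotp (b x a) p - f x a | a in A].

Record standing_assumptions (lambda nu : R) (n : 'rV[R]_d -> 'rV[R]_d)
    (b : 'rV[R]_d -> 'rV[R]_m -> 'rV[R]_d)
    (f : 'rV[R]_d -> 'rV[R]_m -> R) : Prop := {
  sa_nonempty : Om !=set0;
  sa_open : open Om;
  sa_connected : connected Om;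
  sa_bounded : bounded_set Om;
  sa_boundary : C2_boundary_normal Om n;
  sa_compact : compact A;
  sa_lambda : 0 < lambda;
  sa_b_cont : continuous_on_A b;
  sa_b_bounded : bounded_on_A b;
  sa_b_lip : lipschitz_in_x b;
  sa_b_lip_lt : lip_x b < lambda;
  sa_f_ge0 : forall x a, A a -> 0 <= f x a;
  sa_f_cont : continuous_on_A f;
  sa_f_bounded : exists K : R, forall x a, A a -> `|f x a| <= K;
  sa_f_lip : exists L : R, forall x y a, A a ->
    `|f x a - f y a| <= L * enorm (x - y);
  sa_nu : 0 < nu;
  sa_inward : forall x, frontier Om x ->
    exists2 a, A a & dotp (b x a) (n x) <= - nu;
  sa_coercive : forall K : R, exists r : R, forall x p,
    closure Om x -> r <= enorm p -> K <= hamiltonian b f x p }.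

Definition penalty (Mp : R) (x : 'rV[R]_d) : R :=
  Num.min (edistance x (closure Om)) Mp.

Definition policy (pi : 'rV[R]_d -> 'rV[R]_m) : Prop :=
  borel_map pi /\ forall x, A (pi x).

Record inward_feedback (r1 nu0 COm : R)
    (b : 'rV[R]_d -> 'rV[R]_m -> 'rV[R]_d) (dt : 'rV[R]_d -> R)
    (pi : 'rV[R]_d -> 'rV[R]_m) : Prop := {
  if_policy : policy pi;
  if_C11 : C11 dt;
  if_grad : forall x, enorm (grad dt x) <= 1;
  if_hessian : hessian_Linfty_le dt COm;
  if_inside : forall x, closure Om x -> dt x <= 0;
  if_outside : forall x, ~ closure Om x ->
    2^-1 * Num.min (edistance x (closure Om)) r1 <= dt x;
  if_drift : forall x, `|dt x| <= r1 ->
    dotp (b x (pi x)) (grad dt x) <= - nu0 }.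

End Setting.

Section Scheme.
Context {R : realType} {d m : nat}.
Implicit Types (v : 'rV[R]_d -> R) (x : 'rV[R]_d).

Definition grad_h (h : R) v x : 'rV[R]_d :=
  \row_(i < d) ((v (x + h *: unitv i) - v (x - h *: unitv i)) / (2 * h)).

Definition laplace_h (h : R) v x : R :=
  \sum_(i < d) (v (x + h *: unitv i) - 2 * v x + v (x - h *: unitv i)) / h ^+ 2.

Definition nu_h (N h : R) : R := N * h.

Definition scheme_op (lambda N h : R)
    (b : 'rV[R]_d -> 'rV[R]_m -> 'rV[R]_d) (pi : 'rV[R]_d -> 'rV[R]_m) v x : R :=
  lambda * v x - dotp (b x (pi x)) (grad_h h v x) - nu_h N h * laplace_h h v x.

Definition running_cost (Om : set 'rV[R]_d) (Mp eps : R)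
    (f : 'rV[R]_d -> 'rV[R]_m -> R) (pi : 'rV[R]_d -> 'rV[R]_m) x : R :=
  f x (pi x) + penalty Om Mp x / eps.

(* [v] is S_{eps,h}(pi), i.e. the bounded Borel solution of the scheme. *)
Definition is_policy_value (Om : set 'rV[R]_d) (lambda N Mp eps h : R)
    (b : 'rV[R]_d -> 'rV[R]_m -> 'rV[R]_d) (f : 'rV[R]_d -> 'rV[R]_m -> R)
    (pi : 'rV[R]_d -> 'rV[R]_m) v : Prop :=
  [/\ borel_map v,
      exists K : R, forall x, `|v x| <= K &
      forall x, scheme_op lambda N h b pi v x = running_cost Om Mp eps f pi x].

End Scheme.

Section JumpChain.
Context {R : realType}.

Definition Lambda_h (d : nat) (N h : R) : R := 2 * d%:R * N / h.
Definition mu_h (d : nat) (lambda N h : R) : R := lambda + Lambda_h d N h.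
Definition gamma_h (d : nat) (lambda N h : R) : R :=
  Lambda_h d N h / mu_h d lambda N h.

Context {d m : nat}.

(* In both definitions [s = false] stands for +, [s = true] for -. *)
Definition jump_prob (N : R) (b : 'rV[R]_d -> 'rV[R]_m -> 'rV[R]_d)
    (pi : 'rV[R]_d -> 'rV[R]_m) (i : 'I_d) (s : bool) (y : 'rV[R]_d) : R :=
  (N + (-1) ^+ s * (b y (pi y) 0 i / 2)) / (2 * d%:R * N).

Definition jump_to (h : R) (i : 'I_d) (s : bool) (y : 'rV[R]_d) : 'rV[R]_d :=
  y + ((-1) ^+ s * h) *: unitv i.

(* The history event {Y_0 = y_0, ..., Y_k = y_k}. *)
Definition history {T : Type} (Y : nat -> T -> 'rV[R]_d) (y : nat -> 'rV[R]_d)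
    (k : nat) : set T :=
  [set w | forall j, (j <= k)%N -> Y j w = y j].

Record jump_chain (N h : R) (b : 'rV[R]_d -> 'rV[R]_m -> 'rV[R]_d)
    (pi : 'rV[R]_d -> 'rV[R]_m) (x : 'rV[R]_d)
    (disp : measure_display) (T : measurableType disp) (P : probability T R)
    (Y : nat -> T -> 'rV[R]_d) : Prop := {
  jc_measurable : forall k y, measurable (Y k @^-1` [set y]);
  jc_lattice : forall k w, exists z : 'rV[int]_d,
    Y k w = x + h *: map_mx intr z;
  jc_start : forall w, Y 0%N w = x;
  (* P(Y_{k+1} = y_k +- h e_i | Y_0 = y_0, ..., Y_k = y_k) = q_i^{+-}(y_k) *)
  jc_markov : forall k (y : nat -> 'rV[R]_d) i s,
    (P (history Y y k `&` Y k.+1 @^-1` [set jump_to h i s (y k)]) =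
     (jump_prob N b pi i s (y k))%:E * P (history Y y k))%E }.

(* mu^-1 E[sum_{k >= 0} gamma_h^k p(Y_k)] *)
Definition discounted_cost (lambda N h : R) (p : 'rV[R]_d -> R)
    (disp : measure_display) (T : measurableType disp) (P : probability T R)
    (Y : nat -> T -> 'rV[R]_d) : \bar R :=
  ((mu_h d lambda N h)^-1%:E *
   'E_P[fun w => limn (series (fun k =>
          gamma_h d lambda N h ^+ k * p (Y k w)))%R])%E.

End JumpChain.

(* Main.v *)
(* The value w is bounded by an explicit supersolution.  With s the positive part
   of dt, put W = min((2/nu0) s^2 + beta s^3 + Cstar h, Mp/lambda), where
   beta = (Mp/lambda) (2/r1)^3 makes the cap active as soon as dt >= r1/2, so that
   the drift condition is used only for |dt| <= r1 and no control is needed far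
   away.  There one jump moves dt by at most h, and the generator of the chain
   applied to dt equals b . grad dt up to 2dN COm h, hence is at most -nu0/2.  The
   s^2 term then pays for the penalty, which is at most 2s, up to an O(h) error
   independent of Mp and r1; the error of the s^3 term is O(beta h^2), which is
   absorbed by taking h small.  On the closure of Omega, s = 0 and W <= Cstar h.

   Controlling the generator on dt needs that grad dt is COm-Lipschitz along the
   coordinate axes, whereas the Hessian bound holds only almost everywhere and
   the Lipschitz constant in C11 is arbitrary.  A null set meets some line close
   to a given axis-parallel one in a set of small linear measure (Tonelli), and
   on that exceptional set the uncontrolled Lipschitz constant costs little. *)
Require Import Defs.
From mathcomp Require Import measurable_realfun ring lra.
Set Implicit Arguments.
Unset Strict Implicit.
Unset Printing Implicit Defensive.
Local Open Scope classical_set_scope.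
Local Open Scope ring_scope.

(** * Lines almost avoiding a null set *)

Lemma itv_measure_le (R : realType) (a b : R) : a <= b ->
  (lebesgue_measure ([set` `[a, b]] : set R) <= (b - a)%:E)%E.
Proof.
move=> ab; rewrite lebesgue_measure_itv/= lte_fin; case: ltP => // _.
by rewrite lee_fin subr_ge0.
Qed.

(** An averaging argument: if every [x] of the interval had weighted overlap at least [c], Tonelli
    would bound [c * delta] by the total weighted length, hence by [e]. *)
Lemma pick_low_overlap (R : realType) (w lo hi : nat -> R) (a delta e c : R) :
  (forall k, 0 <= w k) -> (forall k, lo k <= hi k) -> 0 <= delta ->
  e < c * delta ->
  (\sum_(0 <= k <oo) (w k * (hi k - lo k))%:E <= e%:E)%E ->
  exists2 x, a <= x <= a + delta &
    (\sum_(0 <= k <oo) (w k * (x \in `[lo k, hi k])%:R)%:E <= c%:E)%E.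
Proof.
move=> w0 lohi d0 ecd le_e; apply: contrapT => Hn.
have Hgt x : a <= x <= a + delta ->
    (c%:E <= \sum_(0 <= k <oo) (w k * (x \in `[lo k, hi k])%:R)%:E)%E.
  move=> xI; rewrite leNgt; apply/negP => /ltW xc; apply: Hn; by exists x.
pose mu := @lebesgue_measure R.
pose D : set R := [set` `[a, a + delta]].
pose f (k : nat) (x : R) := ((w k)%:E * (\1_([set` `[lo k, hi k]]) x)%:E)%E.
have fE k x : f k x = (w k * (x \in `[lo k, hi k])%:R)%:E.
  by rewrite /f indicE mem_setE -EFinM.
have mf k : measurable_fun D (f k).
  apply: measurable_funeM; apply/measurable_EFinP.
  exact: measurable_indic.
have f0 k x : D x -> (0 <= f k x)%E.
  by move=> _; rewrite fE lee_fin mulr_ge0.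
have mD : measurable D by exact: measurable_itv.
have H1 : ((c * delta)%:E <= \int[mu]_(x in D) \sum_(0 <= k <oo) f k x)%E.
  have -> : (c * delta)%:E = (\int[mu]_(x in D) cst c%:E x)%E.
    rewrite integral_cst//= /mu lebesgue_measure_itv/= lte_fin.
    rewrite ltrDl; case: ltP => [_|]; first by rewrite -EFinB -EFinM addrC addKr.
    by move=> dle; have -> : delta = 0 by lra; rewrite mulr0 mule0.
  have [c0|c0] := leP 0 c; last first.
    rewrite integral_cst//=; apply: (@le_trans _ _ 0%E).
      by rewrite mule_le0_ge0// lee_fin ltW.
    by apply: integral_ge0 => x Dx; apply: nneseries_ge0 => k _ _; exact: f0.
  apply: ge0_le_integral => //=.
  - apply: ge0_emeasurable_sum => k *; [exact: f0|exact: mf].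
  - move=> x; rewrite /D/= in_itv/= => /Hgt/le_trans; apply.
    by apply: lee_nneseries => k *; rewrite ?fE// lee_fin mulr_ge0.
have H2 : (\int[mu]_(x in D) \sum_(0 <= k <oo) f k x <= e%:E)%E.
  rewrite integral_nneseries//; apply: le_trans le_e.
  apply: lee_nneseries => k *; first by apply: integral_ge0; exact: f0.
  rewrite ge0_integralZl ?lee_fin//; last first.
    by apply/measurable_EFinP; exact: measurable_indic.
  rewrite integral_indic// EFinM; apply: lee_wpmul2l; first by rewrite lee_fin.
  apply: (@le_trans _ _ (mu [set` `[lo k, hi k]])).
    by apply: le_measure; rewrite ?inE//; (exact: measurableI || exact: subIsetl).
  exact: itv_measure_le.
by move: (le_trans H1 H2); rewrite lee_fin leNgt ecd.
Qed.

(* Averages over [x 0 j, x 0 j + delta], one coordinate j at a time, so that only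
   one-dimensional integrals are needed. *)
Lemma pick_low_overlap_coords (R : realType) (d : nat) (s : seq 'I_d)
    (lo hi : nat -> 'rV[R]_d) (x : 'rV[R]_d) (w : nat -> R) (delta c : R) :
  uniq s -> (forall k, 0 <= w k) -> (forall k i, lo k 0 i <= hi k 0 i) ->
  0 < delta -> 0 < c ->
  (\sum_(0 <= k <oo) (w k * \prod_(j <- s) (hi k 0 j - lo k 0 j))%:E
     <= (c * (delta / 2) ^+ size s)%:E)%E ->
  exists y : 'rV[R]_d,
    [/\ forall j, x 0 j <= y 0 j <= x 0 j + delta,
        forall j, j \notin s -> y 0 j = x 0 j &
    (\sum_(0 <= k <oo)
       (w k * \prod_(j <- s) (y 0 j \in `[lo k 0 j, hi k 0 j])%:R)%:E <= c%:E)%E].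
Proof.
move=> + + lohi d0 c0; elim: s w => [|j s IH] w /=.
  move=> _ w0 H; exists x; split => // [j|]; first by rewrite lexx lerDl ltW.
  move: H; rewrite expr0 mulr1; apply: le_trans.
  by apply: lee_nneseries => k *; rewrite !big_nil// mulr1 lee_fin.
move=> /andP[js us] w0 H.
pose w1 k := w k * \prod_(j <- s) (hi k 0 j - lo k 0 j).
have w1_ge0 k : 0 <= w1 k.
  by apply: mulr_ge0 => //; apply: prodr_ge0 => i _; rewrite subr_ge0.
have cd : 0 < c * (delta / 2) ^+ size s.
  by rewrite mulr_gt0// exprn_gt0// divr_gt0.
(* Halving [delta] once per coordinate provides the strict inequality that [pick_low_overlap] asks
   for. *)
have [|||t txj Ht] := @pick_low_overlap R w1 (fun k => lo k 0 j)
  (fun k => hi k 0 j) (x 0 j) delta (c * (delta / 2) ^+ (size s).+1)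
  (c * (delta / 2) ^+ size s) w1_ge0 (fun k => lohi k j).
- exact: ltW.
- by rewrite exprSr mulrA ltr_pM2l//; lra.
- apply: le_trans H; apply: lee_nneseries => k *.
    by rewrite lee_fin mulr_ge0// subr_ge0.
  by rewrite big_cons /w1 lee_fin mulrAC mulrA.
(* The overlap indicator of the chosen [t] is absorbed into the weights before the recursion on
   [s]. *)
pose w2 k := w k * (t \in `[lo k 0 j, hi k 0 j])%:R.
have [||y [yx yxs Hy]] := IH w2 us.
- by move=> k; rewrite mulr_ge0.
- apply: le_trans Ht; apply: lee_nneseries => k *.
    rewrite lee_fin !mulr_ge0//; apply: prodr_ge0 => i _; by rewrite subr_ge0.
  by rewrite /w1 /w2 lee_fin mulrAC.
exists (\row_i if i == j then t else y 0 i); split => [i|i|].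
- by rewrite mxE; case: eqP => [->|].
- by rewrite inE mxE negb_or => /andP[/negbTE -> /yxs].
apply: le_trans Hy; apply: lee_nneseries => k *.
  by rewrite lee_fin !mulr_ge0//; apply: prodr_ge0.
rewrite lee_fin big_cons /w2 mxE eqxx mulrA ler_wpM2l// ?mulr_ge0//.
rewrite le_eqVlt; apply/orP; left; apply/eqP.
apply: eq_big_seq => i iS; rewrite mxE; case: eqP => // ij.
by rewrite -ij iS in js.
Qed.

(** Cover [Z] by boxes and average over the coordinates other than [i], each box weighted by its
    side in direction [i]. The total weight of the boxes crossed by the chosen line then bounds the
    measure of the parameters at which it meets [Z]. *)
Lemma null_set_nearby_line (R : realType) (d : nat) (Z : set 'rV[R]_d)
    (i : 'I_d) (x : 'rV[R]_d) (delta c : R) :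
  lebesgue_null Z -> 0 < delta -> 0 < c ->
  exists y : 'rV[R]_d,
    (forall j, x 0 j <= y 0 j <= x 0 j + delta) /\
    exists D : set R, [/\ measurable D, (lebesgue_measure D <= c%:E)%E &
      forall t, Z (y + t *: unitv i) -> D t].
Proof.
move=> Z0 d0 c0.
pose s := rem i (enum 'I_d).
have us : uniq s by rewrite rem_uniq// enum_uniq.
have is_ j : (j \in s) = (j != i) by rewrite mem_rem_uniq ?enum_uniq// inE mem_enum andbT.
have prodE (F : 'I_d -> R) : \prod_(j < d) F j = F i * \prod_(j <- s) F j.
  rewrite -[LHS]big_enum/=.
  by rewrite (perm_big _ (perm_to_rem (mem_enum 'I_d i))) big_cons.
have e0 : 0 < c * (delta / 2) ^+ size s by rewrite mulr_gt0// exprn_gt0// divr_gt0.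
have [lo [hi [lohi [Zsub sumle]]]] := Z0 _ e0.
pose w k := hi k 0 i - lo k 0 i.
have w0 k : 0 <= w k by rewrite subr_ge0.
have [|y [yx _ Hy]] := @pick_low_overlap_coords R d s lo hi x w delta c us w0 lohi d0 c0.
  apply: le_trans sumle; apply: lee_nneseries => k *.
    by rewrite lee_fin mulr_ge0//; apply: prodr_ge0 => j _; rewrite subr_ge0.
  by rewrite lee_fin prodE.
exists y; split => //.
(* [on k] says that the line crosses box [k]; [B k] is then the parameter interval of the
   crossing. *)
pose on k := [forall j, (j != i) ==> (y 0 j \in `[lo k 0 j, hi k 0 j])].
pose B k : set R := if on k then [set` `[lo k 0 i - y 0 i, hi k 0 i - y 0 i]] else set0.
have mB k : measurable (B k).
  by rewrite /B; case: ifP => _; [exact: measurable_itv|exact: measurable0].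
exists (\bigcup_k B k); split.
- exact: bigcupT_measurable.
- apply: le_trans Hy.
  apply: (le_trans (measure_sigma_subadditive (@lebesgue_measure R) mB _ _)) => //.
    exact: bigcupT_measurable.
  apply: lee_nneseries => k *; first exact: measure_ge0.
  rewrite /B; case: ifPn => [/forallP onk|_]; last first.
    by rewrite measure0 lee_fin mulr_ge0//; apply: prodr_ge0.
  rewrite big_seq big1 ?mulr1; last first.
    by move=> j; rewrite is_ => ji; have := onk j; rewrite ji => /= ->.
  have <- : (hi k 0 i - y 0 i) - (lo k 0 i - y 0 i) = w k by rewrite /w; ring.
  by apply: itv_measure_le; rewrite lerD2r.
move=> t /Zsub[k _ /= H]; exists k => //; rewrite /B.
have yE j : (y + t *: unitv i) 0 j = y 0 j + t * (j == i)%:R.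
  by rewrite !mxE eqxx.
case: ifPn => [_|/negP[]] /=.
  by rewrite in_itv/=; have := H i; rewrite yE eqxx mulr1; lra.
apply/forallP => j; apply/implyP => ji.
by have := H j; rewrite yE (negbTE ji) mulr0 addr0 in_itv.
Qed.

(** * Lipschitz functions with almost everywhere bounded derivative *)

Lemma derive_growth (R : realType) (g : R -> R) (t dg C eps : R) :
  is_derive t (1 : R) g dg -> `|dg| <= C -> 0 < eps ->
  exists2 r : R, 0 < r & forall s, `|s - t| < r ->
    `|g s - g t| <= (C + eps) * `|s - t|.
Proof.
move=> [dgt dgE] dgC e0.
move: (dgt); rewrite /derivable => /cvgP; move: dgE; rewrite /derive => -> /= gcv.
have /cvgrPdist_le /(_ _ e0) := gcv.
move=> /= /nbhs_ballP[r /= r0 Hr]; exists r => // s str.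
have [->|st] := eqVneq s t; first by rewrite !subrr normr0 mulr0.
have s0 : s - t != 0 by rewrite subr_eq0.
have /(_ _)/= := Hr (s - t).
rewrite /ball/= sub0r normrN => /(_ str s0).
rewrite [_ *: (1 : R)]mulr1 subrK => H.
rewrite -(@ler_pdivrMr _ `|s - t|) ?normr_gt0// -normfV -normrM mulrC.
rewrite (_ : _ * _ = dg - (dg - (s - t)^-1 * (g s - g t))); last by ring.
by apply: (le_trans (ler_normB _ _)); apply: lerD.
Qed.

(** Off [D] the growth rate is at most [C]; on [D] it is at most [L], and [D] has length at most
    [c]. An induction along the interval takes the place of integrating the derivative. *)
Lemma lipschitz_derive_le_off (R : realType) (g : R -> R) (D : set R)
    (L C a b c : R) :
  measurable D -> (lebesgue_measure D <= c%:E)%E ->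
  0 <= L -> (forall s t, `|g s - g t| <= L * `|s - t|) ->
  0 <= C ->
  (forall t, ~ D t -> exists2 dg, is_derive t (1 : R) g dg & `|dg| <= C) ->
  a <= b -> `|g b - g a| <= C * (b - a) + L * c.
Proof.
move=> mD Dc L0 gL C0 gD ab.
suff main eps : 0 < eps ->
    `|g b - g a| <= (C + eps) * (b - a) + L * (c + eps).
  apply/ler_addgt0Pr => e e0.
  have k0 : 0 < b - a + L + 1 by lra.
  have := main (e / (b - a + L + 1)) (divr_gt0 e0 k0).
  move/le_trans; apply.
  have -> : (C + e / (b - a + L + 1)) * (b - a) + L * (c + e / (b - a + L + 1))
    = C * (b - a) + L * c + e / (b - a + L + 1) * (b - a + L) by ring.
  rewrite lerD2l -mulrA ler_piMr ?(ltW e0)// mulrC ler_pdivrMr//; lra.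
move=> e0.
have Dfin : (lebesgue_measure D < +oo)%E by exact: le_lt_trans (ltry c).
(* [D] is enlarged to an open [U]: to the right of a point of [U] a whole interval stays in [U], and
   there [S] grows at unit speed. *)
have [U [oU DU UD]] := lebesgue_regularity_outer mD Dfin e0.
have mU : measurable U by exact: open_measurable.
pose mu := @lebesgue_measure R.
have muU : (mu U <= (c + eps)%:E)%E.
  rewrite -(setDUK DU) EFinD.
  apply: (le_trans (measureU2 _ _ _)) => //; first exact: measurableD.
  by apply: leeD => //; exact: ltW.
pose I t : set R := U `&` [set` `[a, t]].
have mI t : measurable (I t) by apply: measurableI => //; exact: measurable_itv.
have muI t : (mu (I t) <= (c + eps)%:E)%E.
  by apply: le_trans muU; apply: le_measure; rewrite ?inE; [exact: mI|exact: mU|exact: subIsetl].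
have fI t : mu (I t) \is a fin_num.
  by rewrite ge0_fin_numE//; exact: le_lt_trans (muI t) (ltry _).
pose S t := fine (mu (I t)).
have SE t : (S t)%:E = mu (I t) by rewrite /S fineK.
have S_le t : S t <= c + eps by rewrite -lee_fin SE.
have S0 t : 0 <= S t by rewrite -lee_fin SE.
have S_mono s t : s <= t -> S s <= S t.
  move=> st; rewrite -lee_fin !SE; apply: le_measure; rewrite ?inE; [exact: mI|exact: mI|].
  apply: setIS => x /=; rewrite !in_itv/= => /andP[-> xs]; exact: le_trans st.
have S_incr s t : a <= s -> s <= t -> [set` `]s, t]] `<=` U -> S s + (t - s) <= S t.
  move=> as_ st stU; rewrite -lee_fin EFinD !SE.
  have -> : ((t - s)%:E = mu [set` `]s, t]])%E.
    rewrite /mu lebesgue_measure_itv/= lte_fin; case: ltP => [_|ts]; first by rewrite EFinB.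
    by rewrite (@le_anti _ _ s t) ?st ?ts// subrr.
  rewrite -measureU; [|exact: mI|exact: measurable_itv|]; last first.
    by rewrite -subset0 => x [[_]] /=; rewrite !in_itv/=; lra.
  apply: le_measure; rewrite ?inE; [|exact: mI|].
    by apply: measurableU; [exact: mI|exact: measurable_itv].
  move=> x [[Ux]/=|/= xst]; last (split; first exact: stU).
    by rewrite in_itv/= => /andP[ax xs]; split => //=; rewrite in_itv/=; lra.
  by move: xst; rewrite /= !in_itv/=; lra.
(* Continuous induction on [a, b]: inside U the Lipschitz bound is paid for by the
   growth of S, outside U the derivative bound applies. *)
pose B s := (C + eps) * (s - a) + L * S s.
pose X := [set t | a <= t <= b /\ forall s, a <= s <= t -> `|g s - g a| <= B s].
have Xa : X a.
  split; first by rewrite lexx.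
  move=> s sa; have -> : s = a by lra.
  by rewrite subrr normr0 /B subrr mulr0 add0r mulr_ge0.
have supX : has_sup X by split; [exists a|exists b => t [/andP[]]].
pose T := sup X.
have aT : a <= T by apply: ub_le_sup => //; case: supX.
have Tb : T <= b by apply: ge_sup; [exists a|move=> t [/andP[]]].
have ltT s : a <= s < T -> `|g s - g a| <= B s.
  move=> /andP[as_ sT].
  have [t [tab Xt] st] := sup_gt (ex_intro _ a Xa) sT.
  by apply: Xt; rewrite as_ ltW.
(* The bound survives at the supremum: approach [T] from the left with [L * (T - s) <= e], and use
   that [B] is nondecreasing. *)
have BT : `|g T - g a| <= B T.
  have [Ta|aT'] := leP T a.
    have -> : T = a by lra.
    by rewrite subrr normr0 /B subrr mulr0 add0r mulr_ge0.
  apply/ler_addgt0Pr => e e'0.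
  pose s := Num.max a (T - e / (L + 1)).
  have L1 : 0 < L + 1 by lra.
  have sT : s < T by rewrite gt_max aT' ltrBlDr ltrDl divr_gt0.
  have as_ : a <= s by rewrite le_max lexx.
  have Ts : T - s <= e / (L + 1).
    rewrite lerBlDr -lerBlDl le_max lexx orbT//.
  have := ltT s; rewrite as_ sT => /(_ isT) gs.
  have := gL T s; rewrite (gtr0_norm (_ : 0 < T - s)) ?subr_gt0// => gTs.
  have : L * (T - s) <= e.
    have : L * (T - s) <= (L + 1) * (e / (L + 1)) by apply: ler_pM; lra.
    by rewrite [X in _ <= X -> _]mulrC divfK ?gt_eqF.
  have : `|g T - g a| <= `|g T - g s| + `|g s - g a| by exact: ler_distD.
  have : L * S s <= L * S T by apply: ler_wpM2l => //; apply: S_mono; exact: ltW.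
  have : (C + eps) * (s - a) <= (C + eps) * (T - a) by apply: ler_wpM2l; lra.
  rewrite /B in gs *; lra.
have : `|g b - g a| <= B b.
  (* If [T < b], the bound extends a little beyond [T], against the choice of [T] as a supremum. *)
  have [->//|Tnb] := eqVneq b T.
  have {}Tb : T < b by rewrite lt_neqAle eq_sym Tnb.
  suff [r r0 Hr] : exists2 r, 0 < r & forall s, T < s < T + r -> `|g s - g a| <= B s.
    pose t := Num.min b (T + r / 2).
    have Tt : T < t by rewrite lt_min Tb ltrDl divr_gt0.
    have : X t.
      split; first by rewrite ge_min lexx /= andbT; lra.
      move=> s /andP[as_ st]; have [sT|Ts] := ltP s T; first by apply: ltT; rewrite as_.
      have [->//|sT] := eqVneq s T.
      apply: Hr; rewrite lt_neqAle eq_sym sT Ts/=; apply: (le_lt_trans st).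
      by rewrite gt_min; apply/orP; right; lra.
    move=> Xt; have : t <= T by apply: ub_le_sup => //; case: supX.
    by rewrite leNgt Tt.
  have [UT|nUT] := pselect (U T).
    move: (oU); rewrite openE => /(_ _ UT)/nbhs_ballP[r /= r0 rU].
    exists r => // s /andP[Ts sr].
    have := S_incr T s aT (ltW Ts) => /(_ _).
    have sU : [set` `]T, s]] `<=` U.
      move=> x /=; rewrite in_itv/= => xTs; apply: rU; rewrite /ball/=.
      by rewrite distrC ger0_norm; lra.
    move=> /(_ sU) => Ss.
    have := ler_distD (g T) (g s) (g a).
    have := gL s T; rewrite (ger0_norm (_ : 0 <= s - T)) ?subr_ge0 ?(ltW Ts)//.
    have : L * (S T + (s - T)) <= L * S s by exact: ler_wpM2l.
    have : (C + eps) * (T - a) <= (C + eps) * (s - a) by apply: ler_wpM2l; lra.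
    rewrite /B in BT *; lra.
  have [|dg gdg dgC] := gD T; first by move/DU.
  have [r r0 Hr] := derive_growth gdg dgC e0.
  exists r => // s /andP[Ts sr].
  have := Hr s; rewrite ger0_norm ?subr_ge0 ?(ltW Ts)// => /(_ _) gsT.
  have {}gsT := gsT ltac:(lra).
  have := ler_distD (g T) (g s) (g a).
  have : L * S T <= L * S s by apply: ler_wpM2l => //; apply: S_mono; exact: ltW.
  rewrite /B in BT *; lra.
move/le_trans; apply; rewrite /B lerD2l; exact: ler_wpM2l.
Qed.

(** * Increments along the coordinate axes *)

Section Enorm.
Context {R : realType} {d : nat}.
Implicit Types u : 'rV[R]_d.

Lemma enorm_coord_le u i : `|u 0 i| <= enorm u.
Proof.
rewrite -sqrtr_sqr /enorm; apply: ler_wsqrtr; rewrite (bigD1 i)//= lerDl.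
by apply: sumr_ge0 => j _; exact: sqr_ge0.
Qed.

Lemma enorm_ge0 u : 0 <= enorm u. Proof. exact: sqrtr_ge0. Qed.

Lemma enorm_unitv (t : R) (i : 'I_d) : enorm (t *: unitv i) = `|t|.
Proof.
rewrite /enorm (bigD1 i)//= big1 => [|j ji]; last first.
  by rewrite !mxE (negbTE ji) mulr0 expr0n.
by rewrite !mxE !eqxx mulr1 addr0 sqrtr_sqr.
Qed.

Lemma enorm_le_coord u (c : R) : 0 <= c -> (forall i, `|u 0 i| <= c) ->
  enorm u <= d%:R * c.
Proof.
move=> c0 uc; rewrite /enorm -[leRHS]ger0_norm ?mulr_ge0// -sqrtr_sqr.
apply: ler_wsqrtr; rewrite exprMn.
apply: (@le_trans _ _ (\sum_(i < d) c ^+ 2)).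
  apply: ler_sum => i _; rewrite -(ger0_norm (sqr_ge0 (u 0 i))) normrX.
  by rewrite lerXn2r ?nnegrE.
rewrite sumr_const card_ord -[leLHS]mulr_natl ler_wpM2r ?sqr_ge0//.
by rewrite -natrX ler_nat; case: (d) => // n; rewrite leq_pmulr.
Qed.

End Enorm.

(** Both difference quotients are the same function of the increment. *)
Lemma is_derive_line (R : realType) (V W : normedModType R) (F : V -> W)
    (y v : V) (s : R) :
  differentiable F (y + s *: v) ->
  is_derive s (1 : R) (fun t : R => F (y + t *: v)) ('d F (y + s *: v) v).
Proof.
move=> dF.
have E : (fun h : R => h^-1 *: (((fun t : R => F (y + t *: v)) \o shift s) (h *: (1 : R))
      - F (y + s *: v)))
    = (fun h : R => h^-1 *: ((F \o shift (y + s *: v)) (h *: v) - F (y + s *: v))).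
  apply/funext => h /=; congr (_ *: (F _ - _)).
  by rewrite [h *: (1 : R)]mulr1 scalerDl addrCA.
have : derivable F (y + s *: v) v by exact: diff_derivable.
rewrite /derivable -E => dl.
split; first exact: dl.
by rewrite -deriveE// /derive E.
Qed.

Section AxisTaylor.
Context {R : realType} {d : nat}.
Variables (g : 'rV[R]_d -> R) (C : R).
Hypothesis g_C11 : C11 g.

Lemma is_derive_axis (y : 'rV[R]_d) (i : 'I_d) (s : R) :
  is_derive s (1 : R) (fun t : R => g (y + t *: unitv i))
    (grad g (y + s *: unitv i) 0 i).
Proof.
have -> : grad g (y + s *: unitv i) 0 i = 'd g (y + s *: unitv i) (unitv i).
  by rewrite mxE deriveE//; exact: (proj1 g_C11).
by apply: is_derive_line; exact: (proj1 g_C11).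
Qed.

Lemma axis_mvt (y : 'rV[R]_d) (i : 'I_d) (h : R) : 0 <= h ->
  exists2 t, 0 <= t <= h &
    g (y + h *: unitv i) - g y = grad g (y + t *: unitv i) 0 i * h.
Proof.
move=> h0.
have [||t] := @MVT_segment R (fun t => g (y + t *: unitv i))
   (fun t => grad g (y + t *: unitv i) 0 i) 0 h h0.
- by move=> s _; exact: is_derive_axis.
- apply: continuous_subspaceT => s; apply/differentiable_continuous.
  apply/derivable1_diffP; exact: (ex_derive (is_derive := is_derive_axis y i s)).
- by rewrite in_itv/= scale0r addr0 subr0 => tI E; exists t.
Qed.

Hypothesis g_hess : hessian_Linfty_le g C.
Hypothesis C0 : 0 <= C.

(** [lipschitz_derive_le_off] gives the rate [C] on a parallel line close by; the global Lipschitz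
    bound of [C11] carries the estimate back to the line through [x], with an arbitrarily small
    loss. *)
Lemma grad_axis_lipschitz (x : 'rV[R]_d) (i : 'I_d) (t : R) : 0 <= t ->
  `|grad g (x + t *: unitv i) 0 i - grad g x 0 i| <= C * t.
Proof.
move=> t0; have [_ [L' HL']] := g_C11; have [Z Z0 HZ] := g_hess.
pose L := Num.max 0 L'.
have L0 : 0 <= L by rewrite le_max lexx.
have HL y z : `|grad g y 0 i - grad g z 0 i| <= L * enorm (y - z).
  have -> : grad g y 0 i - grad g z 0 i = (grad g y - grad g z) 0 i by rewrite !mxE.
  apply: (le_trans (enorm_coord_le _ _)); apply: (le_trans (HL' _ _)).
  by rewrite ler_wpM2r ?enorm_ge0// le_max lexx orbT.
apply/ler_addgt0Pr => e e0.
(* [K] counts the losses in units of [e / K]: [L] for the exceptional set, [2 * L * d%:R] for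
   shifting both endpoints to the nearby line; the last [1] keeps [K] positive. *)
pose K := L + 2 * L * d%:R + 1.
have d0 : 0 <= d%:R :> R by [].
have Ld : 0 <= L * d%:R by exact: mulr_ge0.
have K0 : 0 < K by rewrite /K -mulrA; lra.
have c0 : 0 < e / K by exact: divr_gt0.
have [y [yx [D [mD Dc ZD]]]] := null_set_nearby_line i x Z0 c0 c0.
pose G s := grad g (y + s *: unitv i) 0 i.
have GL s r : `|G s - G r| <= L * `|s - r|.
  apply: (le_trans (HL _ _)).
  by rewrite opprD addrACA subrr add0r -scalerBl enorm_unitv.
have GD s : ~ D s -> exists2 dg, is_derive s (1 : R) G dg & `|dg| <= C.
  move=> nDs; have [|dG JC] := HZ (y + s *: unitv i); first by move/ZD.
  (* This is the [i]-th diagonal entry of the Hessian, bounded through the operator norm applied to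
     a unit vector. *)
  exists ((unitv i *m 'J (grad g) (y + s *: unitv i)) 0 i); last first.
    apply: (le_trans (enorm_coord_le _ _)); apply: (le_trans (JC _)).
    by have := enorm_unitv (1 : R) i; rewrite scale1r => ->; rewrite normr1 mulr1.
  rewrite /jacobian mul_rV_lin1.
  have := is_derive_line dG => -[dl dE].
  have Ei : G = fun t => (fun t => grad g (y + t *: unitv i)) t 0 i by [].
  split; first by move/derivable_mxP : dl => /(_ 0 i).
  rewrite -dE derive_mx//.
  by rewrite mxE.
have Gt := lipschitz_derive_le_off mD Dc L0 GL C0 GD t0.
have yxd : enorm (y - x) <= d%:R * (e / K).
  apply: enorm_le_coord; first exact: ltW.
  by move=> j; rewrite !mxE; have := yx j => H; rewrite ger0_norm; lra.
have := HL (y + t *: unitv i) (x + t *: unitv i).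
rewrite opprD addrACA subrr addr0 => H1.
have H2 := HL y x.
have Hd : L * enorm (y - x) <= L * (d%:R * (e / K)) by exact: ler_wpM2l.
have EK : L * (e / K) + 2 * (L * (d%:R * (e / K))) + e / K = e.
  have -> : L * (e / K) + 2 * (L * (d%:R * (e / K))) + e / K = K * (e / K).
    by rewrite [in RHS]/K; ring.
  by rewrite mulrC divfK ?gt_eqF.
rewrite /G scale0r addr0 subr0 in Gt.
have := ler_distD (grad g (y + t *: unitv i) 0 i)
  (grad g (x + t *: unitv i) 0 i) (grad g x 0 i).
have := ler_distD (grad g y 0 i)
  (grad g (y + t *: unitv i) 0 i) (grad g x 0 i).
rewrite (distrC (grad g (x + t *: unitv i) 0 i) (grad g (y + t *: unitv i) 0 i)).
lra.
Qed.

(** The mean value theorem puts the gradient at a point of the axis within [h] of [y], and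
    [grad_axis_lipschitz] brings it back to [y]. As that lemma moves forwards only, a backward jump
    is read as a forward one ending at [y]. *)
Lemma axis_taylor (y : 'rV[R]_d) (i : 'I_d) (s : bool) (h : R) : 0 <= h ->
  `|g (jump_to h i s y) - g y - (-1) ^+ s * h * grad g y 0 i| <= C * h ^+ 2.
Proof.
move=> h0; rewrite /jump_to; case: s; rewrite ?expr0 ?expr1 ?mul1r ?mulN1r.
  rewrite scaleNr; set z := y - h *: unitv i.
  have yz : y = z + h *: unitv i by rewrite subrK.
  have [t /andP[t0 th] E] := axis_mvt z i h0.
  have yt : y = (z + t *: unitv i) + (h - t) *: unitv i.
    by rewrite -addrA -scalerDl addrCA subrr addr0.
  rewrite {1}yz -[g z - g _]opprB E.
  have := @grad_axis_lipschitz (z + t *: unitv i) i (h - t).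
  rewrite subr_ge0 => /(_ th); rewrite -yt => H.
  rewrite (_ : _ - _ = (grad g y 0 i - grad g (z + t *: unitv i) 0 i) * h); last by ring.
  rewrite normrM (ger0_norm h0) expr2 mulrA ler_wpM2r//.
  by apply: (le_trans H); rewrite ler_wpM2l//; lra.
have [t /andP[t0 th] ->] := axis_mvt y i h0.
rewrite [h * _]mulrC -mulrBl normrM (ger0_norm h0) expr2 mulrA ler_wpM2r//.
by apply: (le_trans (grad_axis_lipschitz _ _ t0)); rewrite ler_wpM2l.
Qed.

Lemma axis_increment (y : 'rV[R]_d) (i : 'I_d) (s : bool) (h : R) : 0 <= h ->
  (forall x, enorm (grad g x) <= 1) -> `|g (jump_to h i s y) - g y| <= h.
Proof.
move=> h0 g1; have gi x : `|grad g x 0 i| <= 1.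
  exact: le_trans (enorm_coord_le _ _) (g1 x).
rewrite /jump_to; case: s; rewrite ?expr0 ?expr1 ?mul1r ?mulN1r.
  rewrite scaleNr; set z := y - h *: unitv i.
  have yz : y = z + h *: unitv i by rewrite subrK.
  have [t _ E] := axis_mvt z i h0.
  by rewrite {1}yz distrC E normrM (ger0_norm h0) ler_piMl.
have [t _ ->] := axis_mvt y i h0.
by rewrite normrM (ger0_norm h0) ler_piMl.
Qed.

End AxisTaylor.

(** * The barrier *)

Definition pospart (R : realDomainType) (s : R) : R := Num.max s 0.

(** * One-sided Taylor bounds for powers of the positive part *)

Section PosPart.
Context {R : realFieldType}.
Implicit Types s D h : R.

Lemma pospart_ge0 s : 0 <= pospart s.
Proof. by rewrite /pospart le_max lexx orbT. Qed.

Lemma pospart_add2 s D :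
  pospart (s + D) ^+ 2 <= pospart s ^+ 2 + 2 * pospart s * D + D ^+ 2.
Proof.
rewrite /pospart; case: (leP s 0) => s0; case: (leP (s + D) 0) => sD; nra.
Qed.

(** When both arguments are positive the expansion is exact up to [D ^+ 3 <= h ^+ 3]; a jump upwards
    across the kink ends at a height of at most [h]. *)
Lemma pospart_add3 s D h : `|D| <= h ->
  pospart (s + D) ^+ 3 <=
  pospart s ^+ 3 + 3 * pospart s ^+ 2 * D + 3 * pospart s * D ^+ 2 + h ^+ 3.
Proof.
move=> Dh; have h0 : 0 <= h := le_trans (normr_ge0 D) Dh.
have h3 : 0 <= h ^+ 3 by exact: exprn_ge0.
have D3 : D ^+ 3 <= h ^+ 3.
  by apply: (le_trans (ler_norm _)); rewrite normrX lerXn2r ?nnegrE.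
rewrite /pospart; case: (leP s 0) => s0; case: (leP (s + D) 0) => sD.
- by rewrite !expr0n/=; lra.
- rewrite !expr0n/= !mulr0 !mul0r !add0r lerXn2r ?nnegrE ?(ltW sD)//.
  by have := ler_norm D; lra.
(* The factor is [s ^+ 2 + 3 * s * D + 3 * D ^+ 2] with its square completed. *)
- have : 0 <= s * ((s + 3 / 2 * D) ^+ 2 + 3 / 4 * D ^+ 2).
    by rewrite mulr_ge0 ?(ltW s0)// addr_ge0 ?sqr_ge0// mulr_ge0 ?sqr_ge0//; lra.
  by rewrite (@expr0n _ 3)/=; nra.
- by nra.
Qed.

End PosPart.

(** * The transition operator of the chain and comparison for the scheme *)

Section JumpMean.
Context {R : realType} {d m : nat}.
Variables (lambda N h : R) (b : 'rV[R]_d -> 'rV[R]_m -> 'rV[R]_d)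
  (pi : 'rV[R]_d -> 'rV[R]_m).
Hypotheses (d_gt0 : (0 < d)%N) (N_gt0 : 0 < N) (h_gt0 : 0 < h).
Implicit Types (u v : 'rV[R]_d -> R) (y : 'rV[R]_d).

Definition jump_mean v y : R :=
  \sum_(i < d) \sum_(s : bool) jump_prob N b pi i s y * v (jump_to h i s y).

Let dR : d%:R != 0 :> R. Proof. by rewrite pnatr_eq0 -lt0n. Qed.
Let NR : N != 0. Proof. exact: lt0r_neq0. Qed.
Let hR : h != 0. Proof. exact: lt0r_neq0. Qed.

Lemma Lambda_h_ge0 : 0 <= Lambda_h d N h.
Proof. by rewrite /Lambda_h divr_ge0 ?mulr_ge0// ltW. Qed.

Lemma jump_prob_sum y : \sum_(i < d) \sum_(s : bool) jump_prob N b pi i s y = 1.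
Proof.
rewrite (eq_bigr (fun=> d%:R^-1)).
  by rewrite sumr_const card_ord -[LHS]mulr_natl divff.
by move=> i _; rewrite big_bool /jump_prob /= expr0 expr1; field; rewrite dR NR.
Qed.

(** With viscosity [N * h], the scheme gives the two neighbours along axis [i] the coefficients
    [(N + b_i / 2) / h] and [(N - b_i / 2) / h], which are the jump rate times the jump
    probabilities. *)
Lemma scheme_op_jump_mean v y :
  scheme_op lambda N h b pi v y =
  mu_h d lambda N h * v y - Lambda_h d N h * jump_mean v y.
Proof.
have E : Lambda_h d N h * v y = \sum_(i < d) (2 * N / h * v y).
  by rewrite sumr_const card_ord -[RHS]mulr_natl /Lambda_h; field.
rewrite /scheme_op /mu_h mulrDl E -addrA -addrA; congr (_ + _).
rewrite /dotp /laplace_h /nu_h /jump_mean !mulr_sumr -!sumrN -!big_split/=.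
apply: eq_bigr => i _.
rewrite !mxE big_bool /jump_prob /jump_to /Lambda_h /= expr0 expr1 !mul1r !mulN1r scaleNr.
by field; rewrite dR NR hR.
Qed.

(** The two probabilities along axis [i] differ by [b_i / (2 d N)], so the mean displacement of a
    jump times the jump rate is the drift. *)
Lemma Lambda_jump_mean_axis (g : 'rV[R]_d) y :
  Lambda_h d N h * (\sum_(i < d) \sum_(s : bool)
    jump_prob N b pi i s y * ((-1) ^+ s * h * g 0 i)) = dotp (b y (pi y)) g.
Proof.
rewrite mulr_sumr; apply: eq_bigr => i _.
rewrite big_bool /jump_prob /Lambda_h /= expr0 expr1.
by field; rewrite dR NR hR.
Qed.

Hypothesis b_le : forall y i, `|b y (pi y) 0 i| <= 2 * N.

Lemma jump_prob_ge0 i s y : 0 <= jump_prob N b pi i s y.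
Proof.
rewrite /jump_prob divr_ge0// ?mulr_ge0 ?(ltW N_gt0)//.
have := b_le y i; rewrite ler_norml => /andP[b1 b2].
by case: s; rewrite ?expr0 ?expr1; lra.
Qed.

(** Weights that are nonnegative and sum to one preserve affine inequalities. This one form serves
    for monotonicity, for constants and for the Taylor bounds of the barrier. *)
Lemma le_jump_mean_affine u v y (a k c : R) :
  (forall i s, u (jump_to h i s y) <= a + k * v (jump_to h i s y) + c) ->
  jump_mean u y <= a + k * jump_mean v y + c.
Proof.
move=> uv.
have -> : a + k * jump_mean v y + c = \sum_(i < d) \sum_(s : bool)
    jump_prob N b pi i s y * (a + k * v (jump_to h i s y) + c).
  have E : a + c = \sum_(i < d) \sum_(s : bool) jump_prob N b pi i s y * (a + c).
    transitivity ((\sum_(i < d) \sum_(s : bool) jump_prob N b pi i s y) * (a + c)).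
      by rewrite jump_prob_sum mul1r.
    by rewrite mulr_suml; apply: eq_bigr => i _; rewrite mulr_suml.
  rewrite addrAC E /jump_mean mulr_sumr -big_split/=; apply: eq_bigr => i _.
  rewrite mulr_sumr -big_split/=; apply: eq_bigr => s _; ring.
apply: ler_sum => i _; apply: ler_sum => s _.
exact: ler_wpM2l (jump_prob_ge0 i s y) _ _ (uv i s).
Qed.

Lemma le_jump_mean u v y : (forall x, u x <= v x) ->
  jump_mean u y <= jump_mean v y.
Proof.
move=> uv; have := @le_jump_mean_affine u v y 0 1 0.
by rewrite add0r mul1r addr0; apply=> i s; rewrite add0r mul1r addr0.
Qed.

Lemma jump_mean_le u y (a : R) : (forall x, u x <= a) -> jump_mean u y <= a.
Proof.
move=> ua; have := @le_jump_mean_affine u u y a 0 0.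
by rewrite mul0r !addr0; apply=> i s; rewrite mul0r !addr0.
Qed.

(* At a point nearly maximizing u - v the discount strictly contracts u - v. *)
Lemma comparison u v (k K : R) : 0 < lambda ->
  (forall y, u y <= K) -> (forall y, k <= v y) ->
  (forall y, scheme_op lambda N h b pi u y <= scheme_op lambda N h b pi v y) ->
  forall y, u y <= v y.
Proof.
move=> l0 uK kv uv.
pose E := range (fun y => u y - v y).
have supE : has_sup E.
  split; first by exists (u 0 - v 0), 0.
  by exists (K - k) => _ [y _ <-]; apply: lerB.
have leE y : u y - v y <= sup E by apply: ub_le_sup; [case: supE|exists y].
have L0 := Lambda_h_ge0.
have step y : mu_h d lambda N h * (u y - v y) <= Lambda_h d N h * sup E.
  have := uv y; rewrite !scheme_op_jump_mean => H.
  have H2 : jump_mean u y <= sup E + jump_mean v y.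
    have := @le_jump_mean_affine u v y (sup E) 1 0; rewrite mul1r addr0; apply=> i s.
    by rewrite mul1r addr0; have := leE (jump_to h i s y); lra.
  have := ler_wpM2l L0 H2; lra.
have mu0 : 0 < mu_h d lambda N h by rewrite /mu_h ltr_wpDr.
have : sup E <= Lambda_h d N h * sup E / mu_h d lambda N h.
  apply: ge_sup; first by case: supE.
  by move=> _ [y _ <-]; rewrite ler_pdivlMr// mulrC.
rewrite ler_pdivlMr// /mu_h => H y.
have : sup E <= 0 by rewrite -(pmulr_lle0 _ l0); lra.
by have := leE y; lra.
Qed.

End JumpMean.

Lemma penalty_le (R : realType) (d : nat) (Om : set 'rV[R]_d) (Mp : R)
  (x : 'rV[R]_d) : penalty Om Mp x <= Mp.
Proof. by rewrite /penalty ge_min lexx orbT. Qed.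

Lemma edistance_ge0 (R : realType) (d : nat) (D : set 'rV[R]_d) (x : 'rV[R]_d) :
  0 <= edistance x D.
Proof.
have [E0|E0] := pselect ([set enorm (x - y) | y in D] !=set0).
  by apply: lb_le_inf => // _ [y _ <-]; exact: sqrtr_ge0.
(* For empty [D] the infimum takes its default value 0. *)
by rewrite /edistance inf_out// => -[].
Qed.

Lemma penalty_ge0 (R : realType) (d : nat) (Om : set 'rV[R]_d) (Mp : R)
  (x : 'rV[R]_d) : 0 <= Mp -> 0 <= penalty Om Mp x.
Proof. by move=> Mp0; rewrite /penalty le_min edistance_ge0. Qed.

Lemma edistance_self (R : realType) (d : nat) (D : set 'rV[R]_d) (x : 'rV[R]_d) :
  D x -> edistance x D = 0.
Proof.
move=> Dx; apply/eqP; rewrite eq_le edistance_ge0 andbT.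
apply: ge_inf; first by exists 0 => _ [y _ <-]; exact: sqrtr_ge0.
exists x => //; rewrite subrr /enorm big1 ?sqrtr0// => i _.
by rewrite mxE expr0n.
Qed.

(** * The capped barrier is a supersolution *)

Section Barrier.
Context {R : realType} {d m : nat}.
Variables (A : set 'rV[R]_m) (Om : set 'rV[R]_d) (lambda nu0 N COm Mp r1 h : R)
  (b : 'rV[R]_d -> 'rV[R]_m -> 'rV[R]_d) (dt : 'rV[R]_d -> R)
  (pi : 'rV[R]_d -> 'rV[R]_m).
Hypotheses (d_gt0 : (0 < d)%N) (l_gt0 : 0 < lambda) (nu0_gt0 : 0 < nu0)
  (N_gt0 : 0 < N) (COm_ge1 : 1 <= COm) (Mp_gt0 : 0 < Mp) (r1_gt0 : 0 < r1).
Hypothesis b_le : forall y i, `|b y (pi y) 0 i| <= 2 * N.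
Hypothesis inward : inward_feedback A Om r1 nu0 COm b dt pi.
Hypothesis h_gt0 : 0 < h.
Let D0 : R := d%:R * N.

(** Below the level [r1 / 2] the minimum in [if_outside] cannot be [r1], so it is the distance,
    which is then at most [2 * dt x]. *)
Lemma penalty_le_dt x : dt x < r1 / 2 -> penalty Om Mp x <= 2 * pospart (dt x).
Proof.
move=> xr; rewrite /penalty ge_min; apply/orP; left.
have dp : dt x <= pospart (dt x) by rewrite /pospart le_max lexx.
have [cx|ncx] := pselect (closure Om x).
  by rewrite edistance_self// mulr_ge0// pospart_ge0.
have := if_outside inward ncx; rewrite /Num.min; case: ifP => _ H; lra.
Qed.

(** The coefficient [2 / nu0] makes a drift of [- (nu0 / 2)] in [dt] produce [- 2 * s], which
    matches the bound of [penalty_le_dt]. *)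
Definition cubic (beta c s : R) : R :=
  2 / nu0 * pospart s ^+ 2 + beta * pospart s ^+ 3 + c.

(** The linear part of [axis_taylor] averages to the drift, at most [- nu0]; its remainder
    [COm * h ^+ 2], times the jump rate, is at most [nu0 / 2] for small [h]. *)
Lemma Lambda_jump_mean_dt x : `|dt x| <= r1 -> h * (4 * D0 * COm) <= nu0 ->
  Lambda_h d N h * (jump_mean N h b pi dt x - dt x) <= - (nu0 / 2).
Proof.
move=> xr hs.
have C0 : 0 <= COm := le_trans ler01 COm_ge1.
have Dx := axis_taylor (if_C11 inward) (if_hessian inward) C0 x _ _ (ltW h_gt0).
have H : jump_mean N h b pi dt x - dt x <=
    (\sum_(i < d) \sum_(s : bool) jump_prob N b pi i s x *
      ((-1) ^+ s * h * grad dt x 0 i)) + COm * h ^+ 2.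
  have E (k : R) : k = \sum_(i < d) \sum_(s : bool) jump_prob N b pi i s x * k.
    transitivity ((\sum_(i < d) \sum_(s : bool) jump_prob N b pi i s x) * k).
      by rewrite jump_prob_sum// mul1r.
    by rewrite mulr_suml; apply: eq_bigr => i _; rewrite mulr_suml.
  rewrite lerBlDr -addrA [COm * _ + _]E -big_split/=.
  apply: ler_sum => i _; rewrite -big_split/=; apply: ler_sum => s _.
  rewrite -mulrDr ler_wpM2l ?(jump_prob_ge0 N_gt0 b_le)//.
  by have := Dx i s; rewrite ler_norml => /andP[_]; lra.
have L0 : 0 <= Lambda_h d N h := Lambda_h_ge0 N_gt0 h_gt0.
apply: (le_trans (ler_wpM2l L0 H)).
rewrite mulrDr Lambda_jump_mean_axis//.
have -> : Lambda_h d N h * (COm * h ^+ 2) = h * (4 * D0 * COm) / 2.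
  by rewrite /Lambda_h /D0; field; exact: lt0r_neq0.
by have := if_drift inward xr; lra.
Qed.

Lemma cubic_super (beta c : R) x : 0 <= beta -> dt x < r1 / 2 ->
  h * (4 * D0 * COm) <= nu0 ->
  4 * D0 / nu0 * h + beta * (6 * D0 ^+ 2 / nu0 + 2 * D0) * h ^+ 2 <= lambda * c ->
  penalty Om Mp x + Lambda_h d N h * jump_mean N h b pi (cubic beta c \o dt) x
    <= mu_h d lambda N h * cubic beta c (dt x).
Proof.
move=> beta0 xr hs hc.
pose s := pospart (dt x); have s0 : 0 <= s := pospart_ge0 _.
(* [K1] is the derivative of [cubic] at [dt x]; [K2] bounds the higher-order terms over a jump that
   moves [dt] by at most [h]. *)
pose K1 := 2 * (2 / nu0) * s + 3 * beta * s ^+ 2.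
pose K2 := 2 / nu0 * h ^+ 2 + 3 * beta * s * h ^+ 2 + beta * h ^+ 3.
have a0 : 0 <= 2 / nu0 by rewrite divr_ge0// ltW.
have K10 : 0 <= K1 by apply: addr_ge0; rewrite !mulr_ge0 ?sqr_ge0// invr_ge0 ltW.
have L0 : 0 <= Lambda_h d N h := Lambda_h_ge0 N_gt0 h_gt0.
have H1 : jump_mean N h b pi (cubic beta c \o dt) x <=
    (cubic beta c (dt x) - K1 * dt x) + K1 * jump_mean N h b pi dt x + K2.
  apply: (le_jump_mean_affine d_gt0 N_gt0 b_le) => i e /=.
  set D := dt (jump_to h i e x) - dt x.
  have -> : dt (jump_to h i e x) = dt x + D by rewrite addrC subrK.
  have Dh : `|D| <= h := axis_increment (if_C11 inward) x i e (ltW h_gt0) (if_grad inward).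
  have D2 : D ^+ 2 <= h ^+ 2.
    by rewrite -[D ^+ 2]ger0_norm ?sqr_ge0// normrX lerXn2r ?nnegrE// ltW.
  have P2 := ler_wpM2l a0 (pospart_add2 (dt x) D).
  have P3 := ler_wpM2l beta0 (pospart_add3 (dt x) Dh).
  have Q2 := ler_wpM2l a0 D2.
  have Q3 : 3 * beta * s * D ^+ 2 <= 3 * beta * s * h ^+ 2.
    by apply: ler_wpM2l => //; rewrite !mulr_ge0.
  by rewrite /cubic /K1 /K2 -/s in P2 P3 *; lra.
(* Where [dt x <= 0] the slope [K1] vanishes, so the drift is used only for [0 < dt x < r1 / 2],
   within the range of [if_drift]. *)
have H2 : K1 * (Lambda_h d N h * (jump_mean N h b pi dt x - dt x)) <= K1 * - (nu0 / 2).
  have [x0|x0] := leP (dt x) 0.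
    have -> : K1 = 0 by rewrite /K1 /s /pospart (max_idPr x0) mulr0 expr0n mulr0 addr0.
    by rewrite !mul0r.
  by apply: ler_wpM2l => //; apply: Lambda_jump_mean_dt => //; rewrite gtr0_norm//; lra.
have H3 := ler_wpM2l L0 H1.
have H4 := penalty_le_dt xr.
have nu0n0 : nu0 != 0 := lt0r_neq0 nu0_gt0.
have hn0 : h != 0 := lt0r_neq0 h_gt0.
have LK2 : Lambda_h d N h * K2 =
    4 * D0 / nu0 * h + 6 * D0 * beta * s * h + 2 * D0 * beta * h ^+ 2.
  by rewrite /K2 /Lambda_h /D0; field; rewrite nu0n0 hn0.
have K1E : K1 * (nu0 / 2) = 2 * s + 3 / 2 * beta * nu0 * s ^+ 2.
  by rewrite /K1; field; exact: nu0n0.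
(* AM-GM absorbs the error 6 D0 beta s h of the cubic term into its drift. *)
have SQ : 0 <= 3 / 2 * nu0 * beta * (s - 2 * D0 * h / nu0) ^+ 2.
  by apply: mulr_ge0; [rewrite !mulr_ge0// ltW|exact: sqr_ge0].
have SQE : 3 / 2 * nu0 * beta * (s - 2 * D0 * h / nu0) ^+ 2 =
    3 / 2 * beta * nu0 * s ^+ 2 - 6 * D0 * beta * s * h + 6 * D0 ^+ 2 / nu0 * beta * h ^+ 2.
  by field; exact: nu0n0.
(* Of the discount term only the part from [c] is kept; it pays for the remainders that do not
   vanish with [s]. *)
have lc : lambda * c <= lambda * cubic beta c (dt x).
  apply: ler_wpM2l; first exact: ltW.
  by rewrite lerDr; apply: addr_ge0; apply: mulr_ge0 => //; rewrite exprn_ge0// pospart_ge0.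
rewrite /mu_h -/s in H4 *; lra.
Qed.

Definition barrier (beta c M : R) x : R := Num.min (cubic beta c (dt x)) M.

(** At each point the branch attaining the minimum satisfies the inequality, and replacing that
    branch by the smaller barrier at the neighbours only lowers the mean. On the constant branch
    [lambda * M = Mp] dominates the penalty. *)
Lemma barrier_super (beta c M : R) x : M = Mp / lambda ->
  beta = M * (2 / r1) ^+ 3 -> 0 <= c ->
  h * (4 * D0 * COm) <= nu0 ->
  4 * D0 / nu0 * h + beta * (6 * D0 ^+ 2 / nu0 + 2 * D0) * h ^+ 2 <= lambda * c ->
  penalty Om Mp x + Lambda_h d N h * jump_mean N h b pi (barrier beta c M) x
    <= mu_h d lambda N h * barrier beta c M x.
Proof.
move=> ME betaE c0 hs hc.
have L0 : 0 <= Lambda_h d N h := Lambda_h_ge0 N_gt0 h_gt0.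
have M0 : 0 <= M by rewrite ME divr_ge0// ltW.
have beta0 : 0 <= beta by rewrite betaE mulr_ge0// exprn_ge0// divr_ge0// ltW.
have a0 : 0 <= 2 / nu0 by rewrite divr_ge0// ltW.
rewrite {2}/barrier; case: (leP M (cubic beta c (dt x))) => cM.
  rewrite /mu_h mulrDl; apply: lerD.
    by rewrite ME mulrC divfK ?lt0r_neq0// penalty_le.
  apply: ler_wpM2l => //; apply: (jump_mean_le h d_gt0 N_gt0 b_le) => y.
  by rewrite /barrier ge_min lexx orbT.
(* By the choice of [beta], [beta * (r1 / 2) ^+ 3 = M]: from the level [r1 / 2] on, the cubic branch
   has reached the cap. *)
have xr : dt x < r1 / 2.
  rewrite ltNge; apply/negP => xr; move: cM; rewrite ltNge => /negP; apply.
  have r20 : 0 < r1 / 2 by rewrite divr_gt0.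
  have px : r1 / 2 <= pospart (dt x) by rewrite /pospart le_max xr.
  have -> : M = beta * (r1 / 2) ^+ 3 by rewrite betaE; field; rewrite lt0r_neq0.
  have : beta * (r1 / 2) ^+ 3 <= beta * pospart (dt x) ^+ 3.
    by apply: ler_wpM2l => //; rewrite lerXn2r ?nnegrE ?pospart_ge0// ltW.
  have : 0 <= 2 / nu0 * pospart (dt x) ^+ 2 by rewrite mulr_ge0 ?sqr_ge0.
  rewrite /cubic; lra.
apply: le_trans (cubic_super beta0 xr hs hc); rewrite lerD2l; apply: ler_wpM2l => //.
by apply: (le_jump_mean h d_gt0 N_gt0 b_le) => y; rewrite /barrier /= ge_min lexx.
Qed.

Lemma barrier_inside (beta c M : R) x : closure Om x -> barrier beta c M x <= c.
Proof.
move=> /(if_inside inward) dx; rewrite /barrier ge_min; apply/orP; left.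
by rewrite /cubic /pospart (max_idPr dx) !expr0n/= !mulr0 !add0r.
Qed.

Lemma barrier_ge0 (beta c M : R) x : 0 <= beta -> 0 <= c -> 0 <= M ->
  0 <= barrier beta c M x.
Proof.
move=> beta0 c0 M0; rewrite /barrier le_min M0 andbT /cubic.
have a0 : 0 <= 2 / nu0 by rewrite divr_ge0// ltW.
by apply: addr_ge0 => //; apply: addr_ge0; apply: mulr_ge0 => //; rewrite exprn_ge0// pospart_ge0.
Qed.

Lemma barrier_le (beta c M : R) x : barrier beta c M x <= M.
Proof. by rewrite /barrier ge_min lexx orbT. Qed.

End Barrier.

(** * The jump chain *)

Section CountableRange.
Context {disp : measure_display} {T : measurableType disp} {R : realType}
  {I : countType} {U : Type}.
Variables (X : T -> U) (pt : I -> U).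
Hypothesis X_pt : forall w, exists i, X w = pt i.
Hypothesis X_meas : forall i, measurable (X @^-1` [set pt i]).

Lemma countable_range_preimage (B : set U) : measurable (X @^-1` B).
Proof.
pose F n := match pickle_inv n with
  | Some i => if pselect (B (pt i)) then X @^-1` [set pt i] else set0
  | None => set0 end.
have -> : X @^-1` B = \bigcup_n F n.
  apply/seteqP; split=> w /=.
    have [i Xi] := X_pt w => BX; exists (pickle i) => //.
    rewrite /F pickleK_inv; case: pselect => //=; by rewrite -Xi.
  move=> [n _]; rewrite /F; case: pickle_inv => // i.
  by case: pselect => //= Bi ->.
apply: bigcupT_measurable => n; rewrite /F; case: pickle_inv => // i.
by case: pselect => //= _; exact: X_meas.
Qed.

Lemma countable_range_measurable d' (V : measurableType d') (phi : U -> V) :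
  measurable_fun setT (phi \o X).
Proof.
move=> _ B _; rewrite setTI comp_preimage; exact: countable_range_preimage.
Qed.

Hypothesis pt_inj : injective pt.

(** The fibres form a countable measurable partition. The lemma serves for the whole past of the
    chain, on each fibre of which the present state is constant. *)
Lemma integral_le_fibers (P : probability T R) (F G : T -> \bar R) :
  measurable_fun setT F -> measurable_fun setT G ->
  (forall w, (0 <= F w)%E) -> (forall w, (0 <= G w)%E) ->
  (forall i, (\int[P]_(w in X @^-1` [set pt i]) F w
              <= \int[P]_(w in X @^-1` [set pt i]) G w)%E) ->
  (\int[P]_w F w <= \int[P]_w G w)%E.
Proof.
move=> mF mG F0 G0 FG.
pose S n := if pickle_inv n is Some i then X @^-1` [set pt i] else set0.
have mS n : measurable (S n).
  by rewrite /S; case: pickle_inv => // i; exact: X_meas.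
have ST : \bigcup_n S n = setT.
  apply/seteqP; split=> // w _; have [i Xi] := X_pt w.
  by exists (pickle i) => //; rewrite /S pickleK_inv.
have tS : trivIset setT S.
  apply/trivIsetP => n1 n2 _ _ n12; rewrite -subset0 => w [].
  have := @pickle_invK I n1; have := @pickle_invK I n2; rewrite /S.
  case: pickle_inv => //= i2 e2; case: pickle_inv => //= i1 e1 ->.
  by move=> /pt_inj i12; move: n12; rewrite -e1 -e2 i12 eqxx.
rewrite -ST ge0_integral_bigcup//; last by rewrite ST.
rewrite ge0_integral_bigcup//; last by rewrite ST.
apply: lee_nneseries => n *; first exact: integral_ge0.
by rewrite /S; case: pickle_inv => [i|]; rewrite ?integral_set0.
Qed.

End CountableRange.

Lemma jump_to_inj (R : realType) (d : nat) (h : R) (y : 'rV[R]_d) (i j : 'I_d)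
    (s t : bool) : h != 0 -> jump_to h i s y = jump_to h j t y -> (i, s) = (j, t).
Proof.
move=> h0 /addrI /rowP /(_ i); rewrite !mxE !eqxx mulr1 /=.
have sh0 (e : bool) : (-1) ^+ e * h != 0 by rewrite mulf_neq0// signr_eq0.
have [ij|ij] := eqVneq i j; last by rewrite mulr0 => /eqP; rewrite (negbTE (sh0 _)).
rewrite mulr1 ij => /(mulIf h0) st; congr (_, _).
by case: s t st => [] [] //=; rewrite expr0 expr1 => H; exfalso; clear -H; lra.
Qed.

Section JumpChain.
Context {R : realType} {d m : nat} {disp : measure_display}
  {T : measurableType disp}.
Variables (lambda N h : R) (b : 'rV[R]_d -> 'rV[R]_m -> 'rV[R]_d)
  (pi : 'rV[R]_d -> 'rV[R]_m) (x : 'rV[R]_d) (P : probability T R)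
  (Y : nat -> T -> 'rV[R]_d).
Hypotheses (d_gt0 : (0 < d)%N) (l_gt0 : 0 < lambda) (N_gt0 : 0 < N)
  (h_gt0 : 0 < h).
Hypothesis q_ge0 : forall i s y, 0 <= jump_prob N b pi i s y.
Hypothesis JC : jump_chain N h b pi x P Y.
Implicit Types (V W p : 'rV[R]_d -> R).

Let pt (z : 'rV[int]_d) : 'rV[R]_d := x + h *: map_mx intr z.

Let pt_inj : injective pt.
Proof.
move=> z1 z2 /addrI /(scalerI (lt0r_neq0 h_gt0)) /rowP E; apply/rowP => i.
by have := E i; rewrite !mxE => /intr_inj.
Qed.

Lemma jump_chain_measurable k phi : measurable_fun setT (phi \o Y k : T -> R).
Proof.
apply: (@countable_range_measurable _ _ _ _ (Y k) pt) => [w|z].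
  exact: (jc_lattice JC).
exact: (jc_measurable JC).
Qed.

Lemma measurable_history k y : measurable (history Y y k).
Proof.
elim: k => [|k IH].
  rewrite (_ : history Y y 0 = Y 0%N @^-1` [set y 0%N]); first exact: (jc_measurable JC).
  apply/seteqP; split=> w /=; first by apply.
  by move=> H j; rewrite leqn0 => /eqP ->.
rewrite (_ : history Y y k.+1 = history Y y k `&` Y k.+1 @^-1` [set y k.+1]).
  by apply: measurableI => //; exact: (jc_measurable JC).
apply/seteqP; split=> w /= H.
  by split=> [j jk|]; apply: H => //; exact: leqW.
by move=> j; rewrite leq_eqVlt => /orP[/eqP ->|/H.1//]; exact: H.2.
Qed.

(** The past as a list: its nonempty fibres are history events, and it takes countably many
    values. *)
Let past k w := [seq Y j w | j <- iota 0 k.+1].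

Let past_history k l : size l = k.+1 ->
  past k @^-1` [set l] = history Y (nth 0 l) k.
Proof.
move=> sl; apply/seteqP; split=> w /=.
  move=> <- j jk; rewrite /past (nth_map 0%N) ?size_iota// nth_iota//.
move=> H; apply: (@eq_from_nth _ 0); first by rewrite size_map size_iota sl.
move=> j; rewrite size_map size_iota => jk.
by rewrite (nth_map 0%N) ?size_iota// nth_iota// add0n H.
Qed.

Let past_pt k w : exists z, past k w = map pt z.
Proof.
have [z Hz] := choice (fun j => jc_lattice JC j w).
exists [seq z j | j <- iota 0 k.+1]; rewrite -map_comp; apply: eq_map => j /=.
exact: Hz.
Qed.

Let past_meas k z : measurable (past k @^-1` [set map pt z]).
Proof.
have [sz|sz] := eqVneq (size z) k.+1.
  by rewrite past_history ?size_map//; exact: measurable_history.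
rewrite (_ : _ @^-1` _ = set0)// -subset0 => w /= E.
by move: sz; rewrite -(size_map pt) -E size_map size_iota eqxx.
Qed.

(** The jump targets are distinct, so at most one term survives; none does when [v] is not a
    neighbour of [y], whence an inequality. *)
Lemma sum_jump_le V y v : (forall y, 0 <= V y) ->
  \sum_(e : 'I_d * bool)
    (V (jump_to h e.1 e.2 y) * (v == jump_to h e.1 e.2 y)%:R) <= V v.
Proof.
move=> V0; have h0 := lt0r_neq0 h_gt0.
case: (pickP (fun e : 'I_d * bool => v == jump_to h e.1 e.2 y)) => [e0 /eqP ve0|none].
  rewrite (bigD1 e0)//= big1 ?addr0 => [|e ee0].
    by rewrite -ve0 eqxx mulr1.
  rewrite ve0; case: eqP => [/(jump_to_inj h0)|_]; last by rewrite mulr0.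
  by rewrite -!surjective_pairing => E; rewrite E eqxx in ee0.
rewrite big1// => e _; by rewrite none mulr0.
Qed.

Lemma jump_mean_pair V y : jump_mean N h b pi V y =
  \sum_(e : 'I_d * bool) jump_prob N b pi e.1 e.2 y * V (jump_to h e.1 e.2 y).
Proof. by rewrite /jump_mean pair_big. Qed.

Lemma jump_mean_ge0 V y : (forall y, 0 <= V y) -> 0 <= jump_mean N h b pi V y.
Proof.
by move=> V0; rewrite jump_mean_pair sumr_ge0// => e _; rewrite mulr_ge0.
Qed.

(** On each fibre of the past, [jc_markov] gives the mass sent to every neighbour of the present
    state. Counting these targets alone bounds the next expectation from below, as [V] is
    nonnegative. *)
Lemma jump_chain_step V k : (forall y, 0 <= V y) ->
  (\int[P]_w (jump_mean N h b pi V (Y k w))%:E <= \int[P]_w (V (Y k.+1 w))%:E)%E.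
Proof.
move=> V0.
apply: (integral_le_fibers (@past_pt k) (@past_meas k) (inj_map pt_inj)) => [||w|w|z].
- by apply/measurable_EFinP; exact: (@jump_chain_measurable k (jump_mean N h b pi V)).
- by apply/measurable_EFinP; exact: jump_chain_measurable.
- by rewrite lee_fin jump_mean_ge0.
- by rewrite lee_fin.
have mS := @past_meas k z; set S := _ @^-1` _ in mS *.
(* A past at time [k] has length [k.+1], so fibres over other lengths are empty. *)
have [sz|sz] := eqVneq (size z) k.+1; last first.
  rewrite (_ : S = set0) ?integral_set0// -subset0 => w /= E.
  by move: sz; rewrite -(size_map pt) -E size_map size_iota eqxx.
pose y := nth 0 (map pt z).
have SE : S = history Y y k by rewrite /S past_history ?size_map.
pose J (e : 'I_d * bool) := Y k.+1 @^-1` [set jump_to h e.1 e.2 (y k)].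
have mJ e : measurable (J e) by exact: (jc_measurable JC).
have -> : (\int[P]_(w in S) (jump_mean N h b pi V (Y k w))%:E =
    (jump_mean N h b pi V (y k))%:E * P S)%E.
  rewrite -integral_cst//; apply: eq_integral => w; rewrite inE SE => /(_ k (leqnn k)).
  by move=> ->.
have f0 e w : (0 <= (V (jump_to h e.1 e.2 (y k)))%:E * (\1_(J e) w)%:E)%E.
  by rewrite -EFinM lee_fin mulr_ge0.
have mf e : measurable_fun S
    (fun w => (V (jump_to h e.1 e.2 (y k)))%:E * (\1_(J e) w)%:E)%E.
  apply: measurable_funeM; apply/measurable_EFinP; exact: measurable_indic.
apply: (@le_trans _ _ (\int[P]_(w in S) \sum_(e : 'I_d * bool)
    ((V (jump_to h e.1 e.2 (y k)))%:E * (\1_(J e) w)%:E))%E).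
  rewrite ge0_integral_sum// jump_mean_pair -sumEFin ge0_sume_distrl.
    apply: lee_sum => e _; rewrite ge0_integralZl_EFin//; last first.
      by apply/measurable_EFinP; exact: measurable_indic.
    rewrite integral_indic// EFinM setIC SE.
    have E := jc_markov JC k y e.1 e.2.
    by rewrite [X in (_ <= _ * X)%E]E EFinM muleCA muleA.
  by move=> e _; rewrite lee_fin mulr_ge0.
apply: ge0_le_integral => //.
- by move=> w _; apply: sume_ge0.
- exact: emeasurable_sum.
- apply/measurable_EFinP; apply: measurable_funTS; exact: jump_chain_measurable.
move=> w _; under eq_bigr do rewrite -EFinM.
rewrite sumEFin lee_fin; apply: le_trans (sum_jump_le (y k) (Y k.+1 w) V0).
by apply: ler_sum => e _; rewrite indicE; case: eqP => E; [rewrite mem_set|rewrite memNset].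
Qed.

Let mY k phi := @jump_chain_measurable k phi.

Let mEY k (phi : 'rV[R]_d -> R) : measurable_fun setT (fun w => (phi (Y k w))%:E).
Proof. by apply/measurable_EFinP; exact: mY. Qed.

Let PT : P setT = 1%E. Proof. exact: probability_setT. Qed.

Lemma integral_chain_fin V k (K : R) : (forall y, 0 <= V y <= K) ->
  (\int[P]_w (V (Y k w))%:E)%E \is a fin_num.
Proof.
move=> VK; have V0 y : 0 <= V y by case/andP: (VK y).
rewrite ge0_fin_numE; last by apply: integral_ge0 => w _; rewrite lee_fin.
apply: (@le_lt_trans _ _ (\int[P]_w cst K%:E w)%E); last first.
  by rewrite integral_cst// [X in (_ * X)%E]PT mule1 ltry.
apply: ge0_le_integral => // [w _|w _]; rewrite lee_fin//.
by case/andP: (VK (Y k w)).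
Qed.

(** Real-valued expectation at time [k]; by [integral_chain_fin], [fine] loses nothing on bounded
    nonnegative [V]. *)
Let E k V : R := fine (\int[P]_w (V (Y k w))%:E)%E.

Lemma expect_ge0 V k : (forall y, 0 <= V y) -> 0 <= E k V.
Proof. by move=> V0; rewrite fine_ge0//; apply: integral_ge0 => w _; rewrite lee_fin. Qed.

Lemma expectD u v k (K : R) : (forall y, 0 <= u y <= K) -> (forall y, 0 <= v y <= K) ->
  E k (fun y => u y + v y) = E k u + E k v.
Proof.
move=> uK vK; rewrite /E -fineD; try exact: integral_chain_fin uK || exact: integral_chain_fin vK.
have u0 w : setT w -> (0 <= (u (Y k w))%:E)%E.
  by move=> _; rewrite lee_fin; case/andP: (uK (Y k w)).
have v0 w : setT w -> (0 <= (v (Y k w))%:E)%E.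
  by move=> _; rewrite lee_fin; case/andP: (vK (Y k w)).
by rewrite -(ge0_integralD _ measurableT u0 (mEY k u) v0 (mEY k v)).
Qed.

Lemma expectZ u k (a K : R) : 0 <= a -> (forall y, 0 <= u y <= K) ->
  E k (fun y => a * u y) = a * E k u.
Proof.
move=> a0 uK; rewrite /E; under eq_integral do rewrite EFinM.
rewrite ge0_integralZl_EFin//; last first.
  by move=> w _; rewrite lee_fin; case/andP: (uK (Y k w)).
by rewrite fineM//; exact: integral_chain_fin uK.
Qed.

Lemma expect_le u v k (K : R) : (forall y, 0 <= v y <= K) ->
  (forall y, 0 <= u y <= v y) -> E k u <= E k v.
Proof.
move=> vK uv.
have uK y : 0 <= u y <= K.
  by move: (uv y) (vK y) => /andP[-> u1] /andP[_]; exact: le_trans.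
rewrite /E fine_le//; try exact: integral_chain_fin uK || exact: integral_chain_fin vK.
apply: ge0_le_integral => // w _; rewrite lee_fin.
- by case/andP: (uK (Y k w)).
- by case/andP: (uv (Y k w)).
Qed.

Lemma expect_cst k (a : R) : E k (fun=> a) = a.
Proof. by rewrite /E integral_cst// [X in (_ * X)%E]PT mule1. Qed.

(* The lower bound [jump_chain_step] needs a nonnegative function, so the upper
   bound is obtained from it for [M - W]. *)
Lemma expect_jump_mean W (M : R) k : (forall y, 0 <= W y <= M) ->
  E k.+1 W <= E k (jump_mean N h b pi W).
Proof.
move=> WM; pose V y := M - W y.
have V0 y : 0 <= V y by rewrite subr_ge0; case/andP: (WM y).
have W0 y : 0 <= W y by case/andP: (WM y).
have VM y : 0 <= V y <= M by rewrite V0 /= gerBl.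
have PWV y : jump_mean N h b pi W y + jump_mean N h b pi V y = M.
  rewrite !jump_mean_pair -big_split/= -[RHS]mul1r -(jump_prob_sum b pi d_gt0 N_gt0 y).
  rewrite pair_big mulr_suml; apply: eq_bigr => e _; rewrite -mulrDr /V.
  by rewrite addrC subrK.
have PV0 y := jump_mean_ge0 y V0.
have PW0 y := jump_mean_ge0 y W0.
have PVM y : 0 <= jump_mean N h b pi V y <= M by rewrite PV0 /= -[leRHS](PWV y) lerDr.
have PWM y : 0 <= jump_mean N h b pi W y <= M by rewrite PW0 /= -[leRHS](PWV y) lerDl.
have S1 : E k.+1 W + E k.+1 V = M.
  rewrite -(expectD _ WM VM) -[RHS](expect_cst k.+1); congr (E _ _).
  by apply/funext => y; rewrite /V addrC subrK.
have S2 : E k (jump_mean N h b pi W) + E k (jump_mean N h b pi V) = M.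
  rewrite -(expectD _ PWM PVM) -[RHS](expect_cst k); congr (E _ _).
  by apply/funext => y; rewrite PWV.
have : E k (jump_mean N h b pi V) <= E k.+1 V.
  rewrite /E fine_le//; try exact: integral_chain_fin PVM || exact: integral_chain_fin VM.
  exact: jump_chain_step.
lra.
Qed.

Lemma expect_start V : E 0 V = V x.
Proof.
rewrite -[RHS](expect_cst 0); rewrite /E; congr fine; apply: eq_integral => w _.
by rewrite (jc_start JC).
Qed.

(** * Telescoping of the discounted cost *)

Section Discounted.
Variables (p W : 'rV[R]_d -> R) (K M : R).
Hypothesis pK : forall y, 0 <= p y <= K.
Hypothesis WM : forall y, 0 <= W y <= M.
Local Notation mu := (mu_h d lambda N h).
Local Notation Lam := (Lambda_h d N h).
Local Notation gam := (gamma_h d lambda N h).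
Hypothesis super : forall y, p y + Lam * jump_mean N h b pi W y <= mu * W y.

Let L0 : 0 <= Lam. Proof. exact: Lambda_h_ge0. Qed.
Let mu0 : 0 < mu. Proof. by rewrite /mu_h ltr_wpDr. Qed.
Let gam0 : 0 <= gam. Proof. by rewrite /gamma_h divr_ge0// ltW. Qed.
Let gam1 : gam < 1.
Proof. by rewrite /gamma_h ltr_pdivrMr// mul1r /mu_h ltrDr. Qed.

Lemma expect_super k : E k p + Lam * E k.+1 W <= mu * E k W.
Proof.
have W0 y : 0 <= W y by case/andP: (WM y).
have p0 y : 0 <= p y by case/andP: (pK y).
have PW0 y := jump_mean_ge0 y W0.
have muWM y : 0 <= mu * W y <= mu * M.
  rewrite mulr_ge0 ?(ltW mu0)//=.
  by apply: ler_wpM2l; [exact: ltW|case/andP: (WM y)].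
have LPW y : 0 <= Lam * jump_mean N h b pi W y <= mu * M.
  rewrite mulr_ge0//=; apply: le_trans (proj2 (elimT andP (muWM y))).
  by apply: le_trans (super y); rewrite lerDr.
(* [expectD] asks for one bound on both summands; the supersolution inequality itself bounds [p] by
   [mu * M]. *)
have pM y : 0 <= p y <= mu * M.
  rewrite p0/=; apply: le_trans (proj2 (elimT andP (muWM y))).
  by apply: le_trans (super y); rewrite lerDl mulr_ge0.
have PWM y : 0 <= jump_mean N h b pi W y <= M.
  rewrite PW0/=; rewrite -[leRHS]mul1r -(jump_prob_sum b pi d_gt0 N_gt0 y).
  rewrite pair_big mulr_suml jump_mean_pair; apply: ler_sum => e _.
  by apply: ler_wpM2l => //; case/andP: (WM (jump_to h e.1 e.2 y)).
rewrite -(expectZ k (ltW mu0) WM).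
apply: (@le_trans _ _ (E k (fun y => p y + Lam * jump_mean N h b pi W y))).
  rewrite (expectD _ pM LPW) lerD2l (expectZ k L0 PWM).
  by apply: ler_wpM2l => //; exact: expect_jump_mean WM.
apply: (expect_le _ muWM) => y; rewrite super andbT addr_ge0//.
by case/andP: (LPW y).
Qed.

(** As [Lam = mu * gam], multiplying [expect_super] by [gam ^+ n] makes the terms in [W] telescope,
    starting from [W x] at time 0. *)
Lemma expect_partial_sum n :
  \sum_(0 <= k < n) gam ^+ k * E k p <= mu * W x - mu * gam ^+ n * E n W.
Proof.
elim: n => [|n IH].
  by rewrite big_geq// expr0 mulr1 expect_start subrr.
rewrite big_nat_recr//=.
have Lg : Lam = mu * gam by rewrite /gamma_h mulrC divfK// lt0r_neq0.
have := ler_wpM2l (exprn_ge0 n gam0) (expect_super n).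
rewrite {1}Lg mulrDr exprSr => H.
have -> : mu * (gam ^+ n * gam) * E n.+1 W = gam ^+ n * (mu * gam * E n.+1 W) by ring.
have E1 : mu * gam ^+ n * E n W = gam ^+ n * (mu * E n W) by ring.
rewrite E1 in IH; lra.
Qed.

Lemma discounted_cost_le : (discounted_cost lambda N h p P Y <= (W x)%:E)%E.
Proof.
have p0 y : 0 <= p y by case/andP: (pK y).
pose u k w := gam ^+ k * p (Y k w).
have u0 k w : 0 <= u k w by rewrite mulr_ge0// exprn_ge0.
(* A geometric majorant makes each pathwise series converge, so its real limit is the extended sum
   and can be integrated term by term. *)
have ucv w : cvgn (series (u ^~ w)).
  apply: (@series_le_cvg _ _ (geometric K gam)) => // [k|k|].
  - by rewrite /geometric/= mulr_ge0 ?exprn_ge0// (le_trans (p0 0))//; case/andP: (pK 0).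
  - by rewrite /u /geometric/= mulrC ler_wpM2r ?exprn_ge0//; case/andP: (pK (Y k w)).
  - by apply: is_cvg_geometric_series; rewrite ger0_norm.
have uE w : ((limn (series (u ^~ w)))%:E = \sum_(0 <= k <oo) (u k w)%:E)%E.
  rewrite -EFin_lim//; congr (limn _); apply/funext => n /=.
  by rewrite /series/= sumEFin.
rewrite /discounted_cost unlock/=.
have -> : (\int[P]_w (limn (series (fun k => gam ^+ k * p (Y k w))))%:E
    = \sum_(0 <= k <oo) \int[P]_w (u k w)%:E)%E.
  rewrite -integral_nneseries//.
  - by apply: eq_integral => w _; rewrite -uE.
  - by move=> k; exact: (mEY k (fun y => gam ^+ k * p y)).
  - by move=> k w _; rewrite lee_fin.
have uint k : (\int[P]_w (u k w)%:E = (gam ^+ k * E k p)%:E)%E.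
  rewrite -(expectZ k (exprn_ge0 k gam0) pK) /E fineK//.
  apply: (@integral_chain_fin (fun y => gam ^+ k * p y) k (gam ^+ k * K)) => y.
  rewrite mulr_ge0 ?exprn_ge0//= ler_wpM2l ?exprn_ge0//; by case/andP: (pK y).
have S : (\sum_(0 <= k <oo) \int[P]_w (u k w)%:E <= (mu * W x)%:E)%E.
  apply: lime_le.
    by apply: is_cvg_nneseries => k _ _; apply: integral_ge0 => w _; rewrite lee_fin.
  apply: nearW => n; rewrite (eq_bigr (fun k => (gam ^+ k * E k p)%:E)) => [|k _].
    rewrite sumEFin lee_fin (le_trans (expect_partial_sum n))// gerBl.
    rewrite mulr_ge0 ?expect_ge0 ?mulr_ge0 ?exprn_ge0 ?(ltW mu0)// => y.
    by case/andP: (WM y).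
  exact: uint.
apply: (@le_trans _ _ (mu^-1%:E * (mu * W x)%:E)%E).
  by apply: lee_wpmul2l => //; rewrite lee_fin invr_ge0 ltW.
by rewrite -EFinM mulKf// lt0r_neq0.
Qed.

End Discounted.

End JumpChain.

(** * Bounds from the data, choice of the constants and the two estimates *)

Lemma entry_le_sup_max_entry (R : realType) (d m : nat) (A : set 'rV[R]_m)
    (b : 'rV[R]_d -> 'rV[R]_m -> 'rV[R]_d) x a i :
  bounded_on_A A b -> A a -> `|b x a 0 i| <= sup_max_entry A b.
Proof.
move=> [K bK] Aa.
apply: (@le_trans _ _ (\big[Num.max/0]_(j < d) `|b x a 0 j|)).
  exact: (le_bigmax _ (fun j => `|b x a 0 j|) i).
apply: ub_le_sup; last by exists (x, a).
exists K => _ [[y c] [_ Ac] <-] /=.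
apply: bigmax_le; first exact: le_trans (enorm_ge0 _) (bK y c Ac).
by move=> j _; apply: le_trans (enorm_coord_le _ _) (bK y c Ac).
Qed.

Lemma le_sup_abs (R : realType) (d m : nat) (A : set 'rV[R]_m)
    (f : 'rV[R]_d -> 'rV[R]_m -> R) x a :
  (exists K : R, forall x a, A a -> `|f x a| <= K) -> A a ->
  f x a <= sup_abs A f.
Proof.
move=> [K fK] Aa; apply: (le_trans (ler_norm _)).
apply: ub_le_sup; last by exists (x, a).
by exists K => _ [[y c] [_ Ac] <-] /=; exact: fK.
Qed.

Theorem lemma5p5 (R : realType) (d : nat) (lambda nu0 N Mb COm : R) :
  (0 < d)%N -> 0 < lambda -> 0 < nu0 <= 1 -> 0 < N -> 1 <= COm ->
  exists Cstar : R, 1 <= Cstar /\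
  forall Mp r1 : R, 0 < Mp -> 0 < r1 <= 1 ->
  exists h0 : R, 0 < h0 <= 1 /\
  forall (m : nat) (A : set 'rV[R]_m) (Om : set 'rV[R]_d) (nu : R)
         (n : 'rV[R]_d -> 'rV[R]_d)
         (b : 'rV[R]_d -> 'rV[R]_m -> 'rV[R]_d)
         (f : 'rV[R]_d -> 'rV[R]_m -> R)
         (dt : 'rV[R]_d -> R) (pibar : 'rV[R]_d -> 'rV[R]_m),
    standing_assumptions A Om lambda nu n b f ->
    Mb = sup_enorm A b ->
    2^-1 * sup_max_entry A b <= N ->
    inward_feedback A Om r1 nu0 COm b dt pibar ->
    forall h : R, 0 < h <= h0 ->
      (forall x : 'rV[R]_d, closure Om x ->
       forall (disp : measure_display) (T : measurableType disp)
              (P : probability T R) (Y : nat -> T -> 'rV[R]_d),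
         jump_chain N h b pibar x P Y ->
         (discounted_cost lambda N h (penalty Om Mp) P Y <= (Cstar * h)%:E)%E)
      /\
      (forall eps : R, 0 < eps ->
       forall S : 'rV[R]_d -> R,
         is_policy_value Om lambda N Mp eps h b f pibar S ->
         forall x : 'rV[R]_d, closure Om x ->
           S x <= sup_abs A f / lambda + Cstar * h / eps).
Proof.
move=> d_gt0 l_gt0 /andP[nu0_gt0 _] N_gt0 COm_ge1.
pose D0 : R := d%:R * N.
have D0_gt0 : 0 < D0 by rewrite mulr_gt0// ltr0n.
have q0 : 0 <= 4 * D0 / nu0 by rewrite divr_ge0 ?(ltW nu0_gt0)// mulr_ge0// ltW.
(* After multiplication by [lambda * h], the term [4 * D0 / nu0] covers the error of the square and
   the inner [1] that of the cube; the outer [1] ensures [1 <= Cstar]. *)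
pose Cstar := 1 + (4 * D0 / nu0 + 1) / lambda.
have C1 : 1 <= Cstar by rewrite lerDl divr_ge0 ?(ltW l_gt0)// addr_ge0.
exists Cstar; split => // Mp r1 Mp_gt0 /andP[r1_gt0 r1_le1].
pose M := Mp / lambda; pose beta := M * (2 / r1) ^+ 3.
pose K := 6 * D0 ^+ 2 / nu0 + 2 * D0.
have M0 : 0 <= M by rewrite divr_ge0// ltW.
have beta0 : 0 <= beta by rewrite mulr_ge0// exprn_ge0// divr_ge0// ltW.
have K0 : 0 <= K.
  apply: addr_ge0; [apply: divr_ge0; last exact: ltW|]; apply: mulr_ge0 => //.
    exact: sqr_ge0.
  exact: ltW.
have bK0 : 0 < beta * K + 1 by rewrite ltr_wpDl// mulr_ge0.
have DC0 : 0 < 4 * D0 * COm by apply: mulr_gt0; [exact: mulr_gt0|exact: lt_le_trans ltr01 COm_ge1].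
(* The second entry is the smallness used for the drift of [dt]; the third gives
   [beta * K * h <= 1], so the error [beta * K * h ^+ 2] of the cube is at most [h]. *)
exists (Num.min 1 (Num.min (nu0 / (4 * D0 * COm)) (beta * K + 1)^-1)); split.
  by rewrite !lt_min ge_min lexx ltr01 divr_gt0// invr_gt0 bK0.
move=> m A Om nu n b f dt pi SA _ bN inw h /andP[h_gt0].
rewrite !le_min => /and3P[_ hnu hbK].
have hs : h * (4 * D0 * COm) <= nu0 by rewrite -ler_pdivlMr.
have hb : h * (beta * K + 1) <= 1 by rewrite -ler_pdivlMr// mul1r.
have Api x : A (pi x) := (if_policy inw).2 x.
have b_le y i : `|b y (pi y) 0 i| <= 2 * N.
  apply: (le_trans (entry_le_sup_max_entry _ _ (sa_b_bounded SA) (Api y))).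
  by rewrite mulrC -ler_pdivrMr// mulrC.
pose W := barrier nu0 dt beta (Cstar * h) M.
have Ch0 : 0 <= Cstar * h by rewrite mulr_ge0 ?(le_trans ler01 C1)// ltW.
have hc : 4 * D0 / nu0 * h + beta * (6 * D0 ^+ 2 / nu0 + 2 * D0) * h ^+ 2
    <= lambda * (Cstar * h).
  have -> : lambda * (Cstar * h) = lambda * h + (4 * D0 / nu0 + 1) * h.
    by rewrite /Cstar; field; rewrite (lt0r_neq0 l_gt0) (lt0r_neq0 nu0_gt0).
  have lh : 0 <= lambda * h by rewrite mulr_ge0// ltW.
  have : h * (h * (beta * K + 1)) <= h * 1 by rewrite ler_wpM2l// ltW.
  have : 0 <= h * h by rewrite mulr_ge0// ltW.
  rewrite -/K; nra.
have super y : penalty Om Mp y + Lambda_h d N h * jump_mean N h b pi W y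
    <= mu_h d lambda N h * W y.
  exact: (barrier_super d_gt0 l_gt0 nu0_gt0 N_gt0 COm_ge1 Mp_gt0 r1_gt0 b_le inw).
have W0 y : 0 <= W y by exact: barrier_ge0.
have WM y : 0 <= W y <= M by rewrite W0 barrier_le.
have WC x : closure Om x -> W x <= Cstar * h by exact: (barrier_inside inw).
split=> [x xO disp T P Y JC|eps eps0 S [_ [KS SK] Seq] x xO].
  have pM y : 0 <= penalty Om Mp y <= Mp by rewrite penalty_ge0 ?penalty_le// ltW.
  apply: (le_trans (discounted_cost_le d_gt0 l_gt0 N_gt0 h_gt0
    (jump_prob_ge0 N_gt0 b_le) JC pM WM super)).
  by rewrite lee_fin WC.
pose F := sup_abs A f.
(* A supersolution of the scheme: the constant absorbs [f] and [eps^-1 * W] the penalty.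
   [comparison] then bounds [S] directly, without the chain. *)
pose U y := F / lambda + eps^-1 * W y.
have Fl : lambda * (F / lambda) = F by rewrite mulrC divfK// lt0r_neq0.
have e0 : 0 <= eps^-1 by rewrite invr_ge0 ltW.
have SU : S x <= U x.
  apply: (comparison d_gt0 N_gt0 h_gt0 b_le (k := F / lambda) (K := KS) l_gt0).
  - by move=> y; apply: le_trans (ler_norm _) (SK y).
  - by move=> y; rewrite lerDl mulr_ge0.
  move=> y; rewrite Seq scheme_op_jump_mean//.
  have H : jump_mean N h b pi U y <= F / lambda + eps^-1 * jump_mean N h b pi W y + 0.
    by apply: (le_jump_mean_affine d_gt0 N_gt0 b_le) => i s; rewrite addr0.
  have L0 : 0 <= Lambda_h d N h := Lambda_h_ge0 N_gt0 h_gt0.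
  have H1 := ler_wpM2l L0 H.
  have H2 := ler_wpM2l e0 (super y).
  have H3 := le_sup_abs y (sa_f_bounded SA) (Api y).
  have H4 : mu_h d lambda N h * (F / lambda) = F + Lambda_h d N h * (F / lambda).
    by rewrite mulrDl Fl.
  have UE : U y = F / lambda + eps^-1 * W y by [].
  rewrite -/F in H3; rewrite /running_cost UE; lra.
apply: (le_trans SU); rewrite lerD2l [leRHS]mulrC; apply: ler_wpM2l => //.
exact: WC.
Qed.
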